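(* Let $M$ be a filtered manifold such that $\mathrm{gr}(TM)$ is locally trivial as a bundle of Lie algebras and $\mathrm{gr}_{-1}(T_xM)$ generates the Lie algebra $\mathrm{gr}(T_xM)$ for all $x\in M$, and consider linear systems of differential equations $Q^r=\ker(\phi)\subset J^r(E)$, where $E$ and $F$ are vector bundles over $M$ and $\phi:J^r(E)\to F$ is a vector bundle map of constant rank. A solution of a regular differential equation of weighted finite type is already determined by a finite jet in a single point. Hence the solution space of a differential equation of weighted finite type is always finite dimensional.
   Context: Filtered manifolds. A filtered manifold is a smooth manifold $M$ with a filtration $TM=T^{-k}M\supset\dots\supset T^{-1}M$ by smooth subbundles such that $[\xi,\eta]\in\Gamma(T^{i+j}M)$ for $\xi\in\Gamma(T^iM)$, $\eta\in\Gamma(T^jM)$, where $T^jM=TM$ for $j\le -k$ and $T^jM=0$ for $j\ge 0$. Put $\mathrm{gr}_i(TM)=T^iM/T^{i+1}M$ and $\mathrm{gr}(TM)=\bigoplus_{i=-k}^{-1}\mathrm{gr}_i(TM)$. The Lie bracket of vector fields induces a tensorial bracket on $\mathrm{gr}(TM)$ making each fiber $\mathrm{gr}(T_xM)$ a nilpotent graded Lie algebra. Weighted jets. A local vector field $\xi$ has weighted order $\le r$ if $\xi\in\Gamma(T^{-r}M)$; its weighted order $\mathrm{ord}(\xi)$ is the minimal such $r$. A linear differential operator on $C^\infty(M,\mathbb R)$ is of weighted order $\le r$ if it is locally of the form $\sum_i\xi_{i_1}\cdots\xi_{i_{s(i)}}$ with local vector fields $\xi_{i_j}$ satisfying $\sum_{l}\mathrm{ord}(\xi_{i_l})\le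 r$ for all $i$ (zeroth order terms, i.e. multiplication by smooth functions, being of weighted order $\leq 0$). For a vector bundle $E\to M$ of constant rank, two germs $s,s'\in\Gamma_x(E)$ of sections at $x$ are $r$-equivalent if $P(\langle\lambda,s-s'\rangle)(x)=0$ for all differential operators $P$ on functions of weighted order $\le r$ and all sections $\lambda$ of $E^*$. The quotient of $\Gamma_x(E)$ is $J^r_x(E)$, the class of $s$ is $j^r_xs$, and $J^r(E)=\bigsqcup_xJ^r_x(E)$ is a smooth vector bundle over $M$ (weighted jet bundle). Let $\pi^r_s:J^r(E)\to J^s(E)$ ($r>s$) be the natural projections and $j^r:\Gamma(E)\to\Gamma(J^r(E))$, $s\mapsto(x\mapsto j^r_xs)$. All jets here are weighted. Equations and prolongation. A vector bundle map $\phi:J^r(E)\to F$ corresponds to the linear differential operator $D=\phi\circ j^r:\Gamma(E)\to\Gamma(F)$ of weighted order $\le r$. If $\phi$ has constant rank, $Q^r=\ker(\phi)$ is the linear system of differential equations associated to it; a solution of $Q^r$ is a section $s$ of $E$ with $\phi(j^rs)=0$, i.e. $D(s)=0$. The $\ell$-th prolongation of $\phi$ is the bundle map $p_\ell(\phi):J^{r+\ell}(E)\to J^\ell(F)$, $p_\ell(\phi)(j^{r+\ell}_xs)=j^\ell_x(\phi(j^rs))$. The map $\phi$ (and the equation $Q^r$) is called regular if $p_\ell(\phi)$ has constant rank for all $\ell\ge0$ (with $p_0(\phi)=\phi$). Set $Q^{r+\ell}=\ker(p_\ell(\phi))\subset J^{r+\ell}(E)$ for $\ell\ge0$. For $\ell\ge1$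 and $x\in M$ let $g^{r+\ell}_x$ be the kernel of the linear map $Q^{r+\ell}_x\to Q^{r+\ell-1}_x$ given by restriction of $\pi^{r+\ell}_{r+\ell-1}$. The equation $Q^r$ is of (weighted) finite type if there is $m\in\mathbb N$ such that $g^{r+\ell}_x=0$ for all $x\in M$ and all $\ell\ge m$.
   Formalization: M is additionally assumed connected; otherwise the claim fails, e.g. for D = d on functions on a disjoint union of lines, where locally constant solutions are not determined by a jet at one point (and infinitely many components give infinite dimension). *)

(* Defs.v *)
(* MathComp-Analysis: the reals are an arbitrary [R : realType]. *)
From HB Require Import structures.
From mathcomp Require Export all_boot all_order all_algebra.
From mathcomp Require Export all_classical all_reals all_analysis.
Export Order.TTheory GRing.Theory Num.Theory.
Export numFieldNormedType.Exports.

Set Implicit Arguments.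
Unset Strict Implicit.
Unset Printing Implicit Defensive.

Local Open Scope classical_set_scope.
Local Open Scope ring_scope.

(* [e] induces a basis of [W / N]; meant for subspaces [N `<=` W] of [V].
   With [N = [set 0]], [e] is a basis of [W]. *)
Definition is_basis_mod (R : realType) (V : lmodType R) (W N : set V)
    (d : nat) (e : 'I_d -> V) : Prop :=
  (forall v, W v <-> exists c : 'rV[R]_d, N (v - \sum_i c 0 i *: e i)) /\
  (forall c : 'rV[R]_d, N (\sum_i c 0 i *: e i) -> c = 0).

(** * Smooth manifolds *)

(* Iterated directional derivatives. *)
Definition iter_derive (R : realType) (n : nat) (f : 'rV[R]_n -> R)
    (vs : seq 'rV[R]_n) : 'rV[R]_n -> R :=
  foldr (fun v g => fun y => 'D_v g y) f vs.

(* C^oo on the open set [O]. *)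
Definition smooth_rV (R : realType) (n : nat) (O : set 'rV[R]_n)
    (f : 'rV[R]_n -> R) : Prop :=
  forall vs y, O y -> differentiable (iter_derive f vs) y.

(* [cinv] is only meaningful on [cmap @` cdom], [cmap] only on [cdom]. *)
Record chart (R : realType) (n : nat) (M : topologicalType) := Chart {
  cdom : set M;
  cmap : M -> 'rV[R]_n;
  cinv : 'rV[R]_n -> M
}.

Definition is_chart (R : realType) (n : nat) (M : topologicalType)
    (c : chart R n M) : Prop :=
  [/\ open (cdom c), open (cmap c @` cdom c),
      {within cdom c, continuous (cmap c)},
      {within cmap c @` cdom c, continuous (cinv c)} &
      forall x, cdom c x -> cinv c (cmap c x) = x].

Record manifold (R : realType) (n : nat) := Manifold {
  msort :> topologicalType;
  atlas : set (chart R n msort);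
  manifold_hausdorff : hausdorff_space msort;
  manifold_countable : @second_countable msort;
  atlas_chart : forall c, atlas c -> is_chart c;
  atlas_cover : forall x : msort, exists2 c, atlas c & cdom c x;
  atlas_compat : forall c c', atlas c -> atlas c' -> forall i : 'I_n,
    smooth_rV (cmap c @` (cdom c `&` cdom c'))
      (fun y => cmap c' (cinv c y) 0 i)
}.

Section Manifold.
Context {R : realType} {n : nat} (M : manifold R n).

(* Local functions, fields and sections are represented by total ones, of
   which only the values on the open set (or the germ) at hand matter. *)
Definition smooth (U : set M) (f : M -> R) : Prop :=
  forall c, atlas c -> smooth_rV (cmap c @` (cdom c `&` U)) (f \o cinv c).

Definition smooth_at (x : M) (f : M -> R) : Prop :=
  exists2 U, open_nbhs x U & smooth U f.

(* Tangent vectors at [x] act on germs at [x] of smooth functions. They are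
   extended by 0 to functions which are not smooth near [x], so that equality
   of functionals is equality of tangent vectors. *)
Definition tvec : Type := (M -> R) -> R.
HB.instance Definition _ := GRing.Lmodule.on tvec.

Definition chart_tvec (c : chart R n M) (x : M) (a : 'rV[R]_n) : tvec :=
  fun f => if `[< smooth_at x f >] then 'D_a (f \o cinv c) (cmap c x) else 0.

Definition tangent (x : M) : set tvec :=
  [set v | exists c a, [/\ atlas c, cdom c x & v = chart_tvec c x a]].

Definition vfield : Type := M -> tvec.
HB.instance Definition _ := GRing.Lmodule.on vfield.

Definition smooth_vfield (U : set M) (X : vfield) : Prop :=
  (forall x, U x -> tangent x (X x)) /\
  (forall V f, open V -> V `<=` U -> smooth V f ->
     smooth V (fun y => X y f)).

Definition lie (X Y : vfield) : vfield :=
  fun x f => if `[< smooth_at x f >]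
             then X x (fun y => Y y f) - Y x (fun y => X y f) else 0.

Definition smooth_subbundle (S : M -> set tvec) : Prop :=
  forall x0, exists (U : set M) (d : nat) (X : 'I_d -> vfield),
    [/\ open_nbhs x0 U, forall i, smooth_vfield U (X i) &
        forall x, U x -> is_basis_mod (S x) [set 0] (fun i => X i x)].

(** * Filtered manifolds *)

(* [fsub j x] is T^{-j}_x M; the nonnegative filtration degrees are all
   represented by [fsub 0 x], which is 0. *)
Record filtration := Filtration {
  fdepth : nat;
  fsub :> nat -> M -> set tvec;
  fdepth_gt0 : (0 < fdepth)%N;
  fsub0 : forall x, fsub 0 x = [set 0];
  fsubS : forall j x, fsub j x `<=` fsub j.+1 x;
  fsub_top : forall j x, (fdepth <= j)%N -> fsub j x = tangent x;
  fsub_subbundle : forall j, smooth_subbundle (fsub j);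
  fsub_lie : forall i j U X Y, open U ->
    smooth_vfield U X -> (forall x, U x -> fsub i x (X x)) ->
    smooth_vfield U Y -> (forall x, U x -> fsub j x (Y x)) ->
    forall x, U x -> fsub (i + j) x (lie X Y x)
}.

Variable T : filtration.

Definition fsection (j : nat) (U : set M) (X : vfield) : Prop :=
  smooth_vfield U X /\ forall x, U x -> T j x (X x).

(* gr(T_x M) is the quotient [gr_elt x / gr_null x]: an element is given by a
   family [u] with [u j] in T^{-j}_x M representing its component in
   gr_{-j}(T_x M) = T^{-j}_x M / T^{-j+1}_x M. *)
Definition gr_elt (x : M) : set (nat -> tvec) := [set u | forall j, T j x (u j)].

Definition gr_null (x : M) : set (nat -> tvec) :=
  [set u | forall j, T j.-1 x (u j)].

(* Sections of gr(TM) over [U], given by lifts of their components. *)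
Definition gr_section (U : set M) (X : nat -> vfield) : Prop :=
  forall j, fsection j U (X j).

Definition gr_at (X : nat -> vfield) (x : M) : nat -> tvec := fun j => X j x.

(* The bracket of gr(TM): modulo [gr_null x], the value at [x] only depends on
   the values of [X] and [Y] at [x] modulo [gr_null x]. *)
Definition gr_lie (X Y : nat -> vfield) : nat -> vfield :=
  fun m => \sum_(i < m.+1) lie (X i) (Y (m - i)%N).

(* Near every point, gr(TM) has a smooth frame with constant structure
   coefficients, i.e. a trivialization that is fibrewise a Lie algebra
   isomorphism onto a fixed Lie algebra. *)
Definition gr_locally_trivial : Prop :=
  forall x0, exists (U : set M) (d : nat) (e : 'I_d -> nat -> vfield)
      (c : 'I_d -> 'I_d -> 'I_d -> R),
    [/\ open_nbhs x0 U, forall a, gr_section U (e a) &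
      forall x, U x ->
        is_basis_mod (gr_elt x) (gr_null x) (fun a => gr_at (e a) x) /\
        forall a b, gr_null x
          (gr_at (gr_lie (e a) (e b)) x - \sum_k c a b k *: gr_at (e k) x)].

(* Lie subalgebras of gr(T_x M), as subspaces of [gr_elt x] containing
   [gr_null x]. *)
Definition gr_subalgebra (x : M) (S : set (nat -> tvec)) : Prop :=
  [/\ S `<=` gr_elt x, gr_null x `<=` S,
      forall (a : R) u v, S u -> S v -> S (a *: u + v) &
      forall U X Y, open_nbhs x U -> gr_section U X -> gr_section U Y ->
        S (gr_at X x) -> S (gr_at Y x) -> S (gr_at (gr_lie X Y) x)].

Definition gr_generated_by_deg1 (x : M) : Prop :=
  forall S, gr_subalgebra x S ->
    (forall u, gr_elt x u -> (forall j, j != 1%N -> u j = 0) -> S u) ->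
    gr_elt x `<=` S.

(** * Weighted differential operators *)

(* Compositions of multiplications by smooth functions on [V] (of weight 0)
   and of smooth sections over [V] of the T^{-j} M (of weight [j]). *)
Inductive wmonomial (V : set M) : nat -> ((M -> R) -> (M -> R)) -> Prop :=
| wmonomial_id : wmonomial V 0 id
| wmonomial_fun q a P : smooth V a -> wmonomial V q P ->
    wmonomial V q (fun f y => a y * P f y)
| wmonomial_vfield q j X P : fsection j V X -> wmonomial V q P ->
    wmonomial V (j + q) (fun f y => X y (P f)).

(* [P] is on [U] a linear differential operator of weighted order <= r. *)
Definition wdiffop (r : nat) (U : set M) (P : (M -> R) -> (M -> R)) : Prop :=
  forall y, U y -> exists (V : set M) (m : nat) (q : 'I_m -> nat)
      (Q : 'I_m -> (M -> R) -> (M -> R)),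
    [/\ open_nbhs y V, forall i, (q i <= r)%N /\ wmonomial V (q i) (Q i) &
        forall f z, V z -> smooth_at z f -> P f z = \sum_i Q i f z].

(** * Vector bundles *)

Record vbundle := VBundle {
  fib :> M -> lmodType R;
  vrank : nat;
  frames : set (set M * ('I_vrank -> forall x, fib x));
  frames_basis : forall U e, frames (U, e) ->
    open U /\ forall x, U x -> is_basis_mod setT [set 0] (fun i => e i x);
  frames_cover : forall x, exists U e, frames (U, e) /\ U x;
  frames_compat : forall U e V e', frames (U, e) -> frames (V, e') ->
    exists g : 'I_vrank -> 'I_vrank -> M -> R,
      (forall i j, smooth (U `&` V) (g i j)) /\
      forall x, (U `&` V) x -> forall j, e' j x = \sum_i g i j x *: e i x
}.

Definition section (E : vbundle) : Type := forall x, E x.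

End Manifold.

Section SectionLmodule.
Context {R : realType} {n : nat} {M : manifold R n} (E : vbundle M).
Implicit Types s t u : section E.

HB.instance Definition _ := gen_eqMixin (section E).
HB.instance Definition _ := gen_choiceMixin (section E).

Let add s t : section E := fun x => s x + t x.
Let opp s : section E := fun x => - s x.
Let zero : section E := fun x => 0.
Let scale (a : R) s : section E := fun x => a *: s x.

Let addA : associative add.
Proof. by move=> s t u; apply: functional_extensionality_dep => x; exact: addrA. Qed.
Let addC : commutative add.
Proof. by move=> s t; apply: functional_extensionality_dep => x; exact: addrC. Qed.
Let add0 : left_id zero add.
Proof. by move=> s; apply: functional_extensionality_dep => x; exact: add0r. Qed.
Let addN : left_inverse zero opp add.
Proof. by move=> s; apply: functional_extensionality_dep => x; exact: addNr. Qed.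

HB.instance Definition _ :=
  GRing.isZmodule.Build (section E) addA addC add0 addN.

Let scaleA a b s : scale a (scale b s) = scale (a * b) s.
Proof. by apply: functional_extensionality_dep => x; exact: scalerA. Qed.
Let scale1 : left_id 1 scale.
Proof. by move=> s; apply: functional_extensionality_dep => x; exact: scale1r. Qed.
Let scaleDr : right_distributive scale +%R.
Proof. by move=> a s t; apply: functional_extensionality_dep => x; exact: scalerDr. Qed.
Let scaleDl s : {morph scale^~ s : a b / a + b}.
Proof. by move=> a b; apply: functional_extensionality_dep => x; exact: scalerDl. Qed.

HB.instance Definition _ := GRing.Zmodule_isLmodule.Build R (section E)
  scaleA scale1 scaleDr scaleDl.

End SectionLmodule.

Section Sections.
Context {R : realType} {n : nat} {M : manifold R n} (E : vbundle M).

Definition smooth_section (U : set M) (s : section E) : Prop :=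
  forall V e, frames (V, e) -> exists c : 'I_(vrank E) -> M -> R,
    (forall i, smooth (U `&` V) (c i)) /\
    forall x, (U `&` V) x -> s x = \sum_i c i x *: e i x.

Definition smooth_section_at (x : M) (s : section E) : Prop :=
  exists2 U, open_nbhs x U & smooth_section U s.

(* Smooth sections of the dual bundle. *)
Definition smooth_dual (U : set M) (lam : forall x, {scalar E x}) : Prop :=
  forall V s, open V -> V `<=` U -> smooth_section V s ->
    smooth V (fun x => lam x (s x)).

End Sections.

(** * Weighted jets *)

Section Jets.
Context {R : realType} {n : nat} {M : manifold R n} (T : filtration M).
Context {E : vbundle M}.

Definition jet_equiv (r : nat) (x : M) (s t : section E) : Prop :=
  forall U P (lam : forall y, {scalar E y}), open_nbhs x U ->
    wdiffop T r U P -> smooth_dual U lam ->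
    P (fun y => lam y (s y - t y)) x = 0.

(* j^r_x s, as an equivalence class of sections that are smooth near x. *)
Definition jet (r : nat) (x : M) (s : section E) : set (section E) :=
  [set t | smooth_section_at x t /\ jet_equiv r x s t].

(* J^r_x(E), with linear structure a j^r_x s + j^r_x t = j^r_x (a s + t). *)
Definition jet_space (r : nat) (x : M) : set (set (section E)) :=
  jet r x @` [set s | smooth_section_at x s].

(* The projection J^{r'}_x(E) -> J^r_x(E), for r <= r'. *)
Definition jet_proj (r : nat) (x : M) (J : set (section E)) :
    set (section E) :=
  \bigcup_(s in J) jet r x s.

End Jets.

(* Vector bundle maps J^r(E) -> F over the identity. As J^r(E) has local smooth
   frames of the form j^r s, such a map is smooth iff it sends j^r s to a smooth
   section for all smooth local sections s of E. *)
Record jet_map {R : realType} {n : nat} {M : manifold R n}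
    (T : filtration M) (r : nat) (E F : vbundle M) := JetMap {
  jmap :> forall x, set (section E) -> F x;
  jmap_linear : forall (x : M) (a : R) (s t : section E),
    smooth_section_at x s -> smooth_section_at x t ->
    jmap x (jet T r x (a *: s + t)) =
    a *: jmap x (jet T r x s) + jmap x (jet T r x t);
  jmap_smooth : forall (U : set M) (s : section E),
    open U -> smooth_section U s ->
    smooth_section U ((fun x => jmap x (jet T r x s)) : section F)
}.

Section Equation.
Context {R : realType} {n : nat} {M : manifold R n} {T : filtration M}.
Context {r : nat} {E F : vbundle M} (phi : jet_map T r E F).

(* The operator D = phi o j^r. *)
Definition jet_op (s : section E) : section F := fun x => phi x (jet T r x s).

(* p_l(phi)(j^{r+l}_x s) = j^l_x (D s); the union is over all representatives
   of the jet [J], which all yield the same class. *)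
Definition prolong (l : nat) (x : M) (J : set (section E)) :
    set (section F) :=
  \bigcup_(s in J) jet T l x (jet_op s).

Definition constant_rank : Prop :=
  exists d, forall x, exists e : 'I_d -> F x,
    is_basis_mod [set phi x J | J in jet_space T r x] [set 0] e.

(* The sections with l-jet at x in the image of p_l(phi)_x, modulo those with
   l-jet 0, form the image of p_l(phi)_x. *)
Definition prolong_constant_rank (l : nat) : Prop :=
  exists d, forall x, exists e : 'I_d -> section F,
    is_basis_mod (\bigcup_(J in jet_space T (r + l) x) prolong l x J)
      (jet T l x 0) e.

Definition regular : Prop := forall l, prolong_constant_rank l.

(* Q^{r+l}_x = ker p_l(phi)_x *)
Definition equation (l : nat) (x : M) : set (set (section E)) :=
  [set J | jet_space T (r + l) x J /\ prolong l x J = jet T l x 0].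

(* g^{r+l}_x, for 0 < l *)
Definition symbol (l : nat) (x : M) : set (set (section E)) :=
  [set J | equation l x J /\
           jet_proj T (r + l).-1 x J = jet T (r + l).-1 x 0].

Definition finite_type : Prop :=
  exists m, forall x l, (0 < l)%N -> (m <= l)%N ->
    symbol l x = [set jet T (r + l) x 0].

Definition solution : set (section E) :=
  [set s | smooth_section setT s /\ jet_op s = 0].

End Equation.

(* Main.v *)
(* Near a point take a frame X_1, ..., X_N of TM adapted to the filtration, X_a
   being a section of T^{-o_a}M. By a Poincare-Birkhoff-Witt argument the ordered
   monomials in the X_a of weight <= q give linear coordinates on the fibres of
   J^q, in which p_l(phi) together with the projection of J^{r+l} onto J^{r+l-1}
   is a matrix depending smoothly on the point. This matrix is injective where
   g^{r+l} = 0, and hence has a locally bounded left inverse: the derivatives of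
   weight r+l of a solution are bounded by those of smaller weight. Iterating over
   l > m, the (r+m)-jet J of a solution satisfies |dJ| <= C |J| in a chart, so by
   Gronwall's inequality its zero set is open and closed. On a connected manifold
   a solution is therefore determined by its (r+m)-jet at one point, and taking
   this jet embeds the solutions in a finite dimensional space. *)
From HB Require Import structures.
Require Import Defs.
From mathcomp Require Import ring lra zify.

Set Implicit Arguments.
Unset Strict Implicit.
Unset Printing Implicit Defensive.
Local Open Scope classical_set_scope.
Local Open Scope ring_scope.

(** * Smooth functions and tangent vectors *)

(** Jets are bare sets of sections, and smoothness of [phi] only says that smooth sections go to
    smooth sections; J^q has no charts of its own. All analysis is therefore done on the functions
    [word_op w (coord i s)] for sorted words [w]. Two facts turn these into coordinates on J^q_x.
    Words of weight <= q, sorted or not, are combinations of sorted ones with smooth coefficients;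
    and the values of the sorted words at one point can be prescribed freely. The second fact also
    realises a kernel vector of the matrix of p_l(phi) by an actual section, which is how the
    vanishing of g^{r+l}, a statement about jets, reaches the matrix. A frame field has a weight o_a
    that may exceed 1, so one derivative of a jet coordinate of weight r+m may have weight r+m+o_a.
    Hence a single step of the estimate does not close the system for J: one descends from r+m+k,
    where k bounds all o_a. Each step has its own neighbourhood, but finitely many suffice, and
    neither neighbourhoods nor constants depend on the solution. Gronwall is then needed only along
    straight segments in a chart. *)

Section SmoothRV.
Context {R : realType} {n : nat}.
Implicit Types (O : set 'rV[R]_n) (f g : 'rV[R]_n -> R).

Lemma near0_differentiable (V W : normedModType R) (h : V -> W) (y : V) :
  {near y, h =1 cst 0} -> differentiable h y.
Proof.
move=> h0.
have hE : h \o shift y = cst (h y) + \0 +o_ 0 id.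
  apply/eqaddoP => _/posnumP[e].
  have h1 : \forall z \near y, h z = 0 by exact: h0.
  move: h1; rewrite (near_shift 0 y) /=; apply: filterS => z /=.
  rewrite subr0 => hz.
  rewrite !fctE /= /shift /= hz (nbhs_singleton h0) /=.
  by rewrite addr0 subr0 normr0 mulr_ge0.
have c0 : continuous (\0 : V -> W) by move=> x; exact: cst_continuous.
have dE : 'd h y = \0 :> (V -> W) by apply: diff_unique.
by apply/diff_locallyP; rewrite dE.
Qed.

(** The difference of the two functions vanishes near [y], hence is differentiable there with
    differential 0. *)
Lemma near_eq_differentiable f g (y : 'rV[R]_n) :
  {near y, f =1 g} -> differentiable f y -> differentiable g y.
Proof.
move=> fg df; rewrite (_ : g = f + (g - f)); last by rewrite addrC subrK.
apply: differentiableD => //; apply: near0_differentiable.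
by apply: filterS fg => z; rewrite !fctE => ->; rewrite subrr.
Qed.

(** The recursion peels off the derivative taken first and bounds the order, so that the product and
    quotient rules can be proved by induction: the derivative of a product again contains the
    undifferentiated factors, now at a lower order. *)
Fixpoint cont_diff O (k : nat) f : Prop :=
  (forall y, O y -> differentiable f y) /\
  if k is k'.+1 then forall v, cont_diff O k' (fun y => 'D_v f y) else True.

Lemma smooth_rVP O f : smooth_rV O f <-> forall k, cont_diff O k f.
Proof.
split.
- move=> sf k; elim: k f sf => [|k IH] f sf /=; first by (split=> // y Oy; exact: (sf [::])).
  split=> [y Oy|v]; first exact: (sf [::]).
  apply: IH => vs y Oy; move: (sf (rcons vs v) y Oy).
  by rewrite /iter_derive foldr_rcons.
- move=> sf vs; elim/last_ind: vs f sf => [|vs v IH] f sf y Oy.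
    by case: (sf 0%N) => H _; exact: H.
  rewrite /iter_derive foldr_rcons; apply: IH => // k.
  by case: (sf k.+1) => _ /(_ v).
Qed.

Lemma cont_diff_le O k f : cont_diff O k.+1 f -> cont_diff O k f.
Proof.
elim: k f => [|k IH] f; first by case=> H _; split.
by move=> [H1 H2]; split=> // v; apply: IH; exact: H2.
Qed.

Lemma cont_diff_ext O k f g : open O -> (forall y, O y -> f y = g y) -> cont_diff O k f -> cont_diff O k g.
Proof.
move=> oO; elim: k f g => [|k IH] f g fg [df H].
all: have ny y : O y -> {near y, f =1 g}
  by move=> Oy; apply: filterS (open_nbhs_nbhs (conj oO Oy)) => z Oz; apply: fg.
all: split=> //.
all: try by move=> y Oy; apply: near_eq_differentiable (df _ Oy); exact: ny.
by move=> v; apply: IH (H v) => y Oy; apply: near_eq_derive; exact: ny.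
Qed.

Lemma cont_diff_cst O k (a : R) : open O -> cont_diff O k (fun=> a).
Proof.
move=> oO; elim: k a => [|k IH] a; split=> //; try by move=> y _; exact: differentiable_cst.
move=> v; apply: (cont_diff_ext (f := fun=> 0)) => // y _.
by rewrite derive_cst.
Qed.

Lemma cont_diffD O k f g : open O -> cont_diff O k f -> cont_diff O k g -> cont_diff O k (fun y => f y + g y).
Proof.
move=> oO; elim: k f g => [|k IH] f g /[dup] cf [df Df] /[dup] cg [dg Dg].
all: have dD y : O y -> differentiable (fun y => f y + g y) y
   by move=> Oy; apply: differentiableD; [exact: df|exact: dg].
all: split=> //.
move=> v; apply: (cont_diff_ext oO _ (IH _ _ (Df v) (Dg v))) => y Oy.
by rewrite -(@deriveD _ _ _ f g) //; apply: diff_derivable; [exact: df|exact: dg].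
Qed.

Lemma cont_diffM O k f g : open O -> cont_diff O k f -> cont_diff O k g -> cont_diff O k (fun y => f y * g y).
Proof.
move=> oO; elim: k f g => [|k IH] f g /[dup] cf [df Df] /[dup] cg [dg Dg].
all: have dD y : O y -> differentiable (fun y => f y * g y) y
   by move=> Oy; apply: differentiableM; [exact: df|exact: dg].
all: split=> //.
move=> v; have H := cont_diffD oO (IH _ _ (cont_diff_le cf) (Dg v)) (IH _ _ (cont_diff_le cg) (Df v)).
apply: (cont_diff_ext oO _ H) => y Oy.
by rewrite (@deriveM _ _ f g) //; apply: diff_derivable; [exact: df|exact: dg].
Qed.

(** The derivative -(1/f)^2 D_v f contains 1/f only at the lower order, which the induction
    hypothesis covers. *)
Lemma cont_diffV O k f : open O -> (forall y, O y -> f y != 0) -> cont_diff O k f ->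
  cont_diff O k (fun y => (f y)^-1).
Proof.
move=> oO f0; elim: k f f0 => [|k IH] f f0 /[dup] cf [df Df].
all: have dD y : O y -> differentiable (fun y => (f y)^-1) y
   by move=> Oy; apply: differentiableV; [exact: df|exact: f0].
all: split=> //.
move=> v; have cV := IH _ f0 (cont_diff_le cf).
have H := cont_diffM oO (cont_diffM oO (cont_diff_cst _ (-1) oO) (cont_diffM oO cV cV)) (Df v).
apply: (cont_diff_ext oO _ H) => y Oy /=.
rewrite (@deriveV _ _ f) ?f0 //; last by apply: diff_derivable; exact: df.
rewrite /GRing.scale /=; congr (_ * _).
by rewrite mulN1r; congr (- _); rewrite expr2 invfM.
Qed.

End SmoothRV.

(** * Smooth functions on the manifold, and tangent vectors in charts *)

Section SmoothM.
Context {R : realType} {n : nat} {M : manifold R n}.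
Implicit Types (U V : set M) (f g : M -> R).

Lemma chart_open (c : chart R n M) U : atlas c -> open U ->
  open (cmap c @` (cdom c `&` U)).
Proof.
move=> /atlas_chart [od oi cc ci K] oU.
have -> : cmap c @` (cdom c `&` U) = (cmap c @` cdom c) `&` (cinv c @^-1` U).
  apply/seteqP; split=> [_ [x [dx Ux] <-]|_ [[x dx <-] /=]].
    by split; [exists x|rewrite /= K].
  by rewrite K // => Ux; exists x.
by rewrite setIC (open_setIS (cinv c @^-1` U)) //; move/continuousP: ci; exact.
Qed.


Lemma smoothS U V f : V `<=` U -> smooth U f -> smooth V f.
Proof.
move=> VU sf c ac vs y [x [dx Vx] <-]; apply: (sf c ac vs); exists x => //.
by split=> //; exact: VU.
Qed.

Lemma smooth_at_in U f x : open U -> U x -> smooth U f -> smooth_at x f.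
Proof. by move=> oU Ux sf; exists U. Qed.

Let smoothP U f : smooth U f <->
  forall c, atlas c -> forall k, cont_diff (cmap c @` (cdom c `&` U)) k (f \o cinv c).
Proof. by split=> H c ac; apply/smooth_rVP; exact: H. Qed.

Lemma smooth_ext U f g : open U -> (forall x, U x -> f x = g x) ->
  smooth U f -> smooth U g.
Proof.
move=> oU fg /smoothP sf; apply/smoothP => c ac k.
apply: cont_diff_ext (sf c ac k); first exact: chart_open.
move=> y [x [dx Ux] <-] /=; have [_ _ _ _ K] := atlas_chart ac.
by rewrite K // fg.
Qed.

Lemma smooth_at_near x f g : {near x, f =1 g} -> smooth_at x f -> smooth_at x g.
Proof.
rewrite /prop_near1 nbhsE => -[V [oV Vx] fg] [U [oU Ux] sf].
exists (U `&` V); first by split; [exact: openI|].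
apply: smooth_ext (smoothS _ sf); [exact: openI|by move=> z [_ /fg]|exact: subIsetl].
Qed.

Lemma smooth_cst U (a : R) : open U -> smooth U (fun=> a).
Proof. by move=> oU; apply/smoothP => c ac k; apply: cont_diff_cst; exact: chart_open. Qed.

Lemma smoothD U f g : open U -> smooth U f -> smooth U g -> smooth U (fun x => f x + g x).
Proof.
move=> oU /smoothP sf /smoothP sg; apply/smoothP => c ac k.
by apply: cont_diffD (sf c ac k) (sg c ac k); exact: chart_open.
Qed.

Lemma smoothM U f g : open U -> smooth U f -> smooth U g -> smooth U (fun x => f x * g x).
Proof.
move=> oU /smoothP sf /smoothP sg; apply/smoothP => c ac k.
by apply: cont_diffM (sf c ac k) (sg c ac k); exact: chart_open.
Qed.

Lemma smoothV U f : open U -> (forall x, U x -> f x != 0) -> smooth U f ->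
  smooth U (fun x => (f x)^-1).
Proof.
move=> oU f0 /smoothP sf; apply/smoothP => c ac k.
apply: cont_diffV (sf c ac k); first exact: chart_open.
move=> y [x [dx Ux] <-] /=; have [_ _ _ _ K] := atlas_chart ac.
by rewrite K // f0.
Qed.

Lemma smoothZ U (a : R) f : open U -> smooth U f -> smooth U (fun x => a * f x).
Proof. by move=> oU sf; apply: smoothM => //; exact: smooth_cst. Qed.

Lemma smoothN U f : open U -> smooth U f -> smooth U (fun x => - f x).
Proof.
move=> oU sf; apply: (smooth_ext oU _ (smoothZ (-1) oU sf)) => x _ /=.
by rewrite mulN1r.
Qed.

Lemma smoothB U f g : open U -> smooth U f -> smooth U g -> smooth U (fun x => f x - g x).
Proof. by move=> oU sf sg; apply: smoothD => //; exact: smoothN. Qed.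

Lemma smooth_sum U (I : Type) (r : seq I) (P : pred I) (F : I -> M -> R) : open U ->
  (forall i, P i -> smooth U (F i)) -> smooth U (fun x => \sum_(i <- r | P i) F i x).
Proof.
move=> oU sF; elim: r => [|i r IH].
  by apply: smooth_ext (smooth_cst 0 oU) => // x _; rewrite big_nil.
have [Pi|Pi] := boolP (P i); last by apply: smooth_ext IH => // x _; rewrite big_cons (negbTE Pi).
by apply: smooth_ext (smoothD oU (sF i Pi) IH) => // x _; rewrite big_cons Pi.
Qed.

Lemma smooth_prod U (I : Type) (r : seq I) (P : pred I) (F : I -> M -> R) : open U ->
  (forall i, P i -> smooth U (F i)) -> smooth U (fun x => \prod_(i <- r | P i) F i x).
Proof.
move=> oU sF; elim: r => [|i r IH].
  by apply: smooth_ext (smooth_cst 1 oU) => // x _; rewrite big_nil.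
have [Pi|Pi] := boolP (P i); last by apply: smooth_ext IH => // x _; rewrite big_cons (negbTE Pi).
by apply: smooth_ext (smoothM oU (sF i Pi) IH) => // x _; rewrite big_cons Pi.
Qed.

Lemma smooth_mulmx U p q m (A : M -> 'M[R]_(p, q)) (B : M -> 'M[R]_(q, m)) :
  open U -> (forall i j, smooth U (fun x => A x i j)) ->
  (forall i j, smooth U (fun x => B x i j)) ->
  forall i j, smooth U (fun x => (A x *m B x) i j).
Proof.
move=> oU sA sB i j.
apply: (smooth_ext (f := fun x => \sum_k A x i k * B x k j)) => // [x _|].
  by rewrite mxE.
by apply: smooth_sum => // k _; exact: smoothM.
Qed.

Lemma smooth_near (x : M) (f : M -> R) : smooth_at x f ->
  \forall z \near x, smooth_at z f.
Proof.
move=> [V oV sf]; apply: filterS (open_nbhs_nbhs oV) => z Vz.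
by exists V => //; split=> //; case: oV.
Qed.

Lemma smooth_atD (x : M) (f g : M -> R) : smooth_at x f -> smooth_at x g ->
  smooth_at x (fun y => f y + g y).
Proof.
move=> [U [oU Ux] sf] [V [oV Vx] sg]; exists (U `&` V); first by split; [exact: openI|].
by apply: smoothD; [exact: openI|exact: smoothS sf|exact: smoothS sg].
Qed.

Lemma smooth_atM (x : M) (f g : M -> R) : smooth_at x f -> smooth_at x g ->
  smooth_at x (fun y => f y * g y).
Proof.
move=> [U [oU Ux] sf] [V [oV Vx] sg]; exists (U `&` V); first by split; [exact: openI|].
by apply: smoothM; [exact: openI|exact: smoothS sf|exact: smoothS sg].
Qed.

Lemma smooth_at_cst (x : M) (k : R) : smooth_at x (fun=> k).
Proof. by exists setT; [split; [exact: openT|]|exact/smooth_cst/openT]. Qed.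

Lemma smooth_at_sum (x : M) (I : Type) (r : seq I) (F : I -> M -> R) :
  (forall i, smooth_at x (F i)) -> smooth_at x (fun y => \sum_(i <- r) F i y).
Proof.
move=> sF; elim: r => [|i r IH].
  apply: smooth_at_near (smooth_at_cst x 0).
  by apply: nearW => z; rewrite big_nil.
apply: smooth_at_near (smooth_atD (sF i) IH).
by apply: nearW => z; rewrite big_cons.
Qed.

Lemma smooth_det U p (A : M -> 'M[R]_p) :
  open U -> (forall i j, smooth U (fun x => A x i j)) -> smooth U (fun x => \det (A x)).
Proof.
move=> oU sA; apply: smooth_sum => // s _; apply: smoothM => //; first exact: smooth_cst.
exact: smooth_prod.
Qed.

(** Cramer's rule: the entries of the inverse are cofactors divided by the determinant. *)
Lemma smooth_invmx U p (A : M -> 'M[R]_p) : open U ->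
  (forall i j, smooth U (fun x => A x i j)) ->
  (forall x, U x -> A x \in unitmx) ->
  forall i j, smooth U (fun x => invmx (A x) i j).
Proof.
move=> oU sA uA i j.
apply: (smooth_ext (f := fun x => (\det (A x))^-1 * cofactor (A x) j i)) => //.
  by move=> x Ux; rewrite /invmx uA // !mxE.
apply: smoothM => //.
  apply: smoothV => //; last exact: smooth_det.
  by move=> x /uA; rewrite unitmxE unitfE.
apply: smoothM => //; first exact: smooth_cst.
apply: smooth_det => // a b; apply: smooth_ext (sA (lift j a) (lift i b)) => // x _.
by rewrite !mxE.
Qed.

Lemma smooth_at_diff f x (c : chart R n M) : atlas c -> cdom c x ->
  smooth_at x f -> differentiable (f \o cinv c) (cmap c x).
Proof.
move=> ac dx [U [oU Ux] sf]; apply: (sf c ac [::]).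
by exists x.
Qed.

Lemma chart_continuous (c : chart R n M) x : atlas c -> cdom c x ->
  continuous_at x (cmap c).
Proof.
move=> ac dx; have [od _ cc _ _] := atlas_chart ac.
by move: cc; rewrite continuous_open_subspace // => /(_ x); apply; rewrite inE.
Qed.

Lemma smooth_continuous U f x : open U -> U x -> smooth U f -> continuous_at x f.
Proof.
move=> oU Ux sf; have [c ac dx] := atlas_cover x.
have [od _ _ _ K] := atlas_chart ac.
have df := differentiable_continuous (smooth_at_diff ac dx (smooth_at_in oU Ux sf)).
have cf : {for x, continuous ((f \o cinv c) \o cmap c)}.
  by apply: continuous_comp; [exact: chart_continuous|exact: df].
have cf' : ((f \o cinv c) \o cmap c) y @[y --> x] --> f x.
  by have := cf; rewrite /prop_for /continuous_at /= K.
apply: cvg_trans cf'; apply: near_eq_cvg.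
by apply: filterS (open_nbhs_nbhs (conj od dx)) => z dz /=; rewrite K.
Qed.

Definition chart_coord (c : chart R n M) (i : 'I_n) : M -> R := fun x => cmap c x 0 i.

Lemma smooth_chart_coord c i : atlas c -> smooth (cdom c) (chart_coord c i).
Proof. by move=> ac c' ac'; exact: atlas_compat. Qed.

Lemma smooth_at_chart_coord c i x : atlas c -> cdom c x -> smooth_at x (chart_coord c i).
Proof.
move=> ac dx; have [od _ _ _ _] := atlas_chart ac.
by apply: smooth_at_in od dx _; exact: smooth_chart_coord.
Qed.

Lemma deriveMx_rv (f : 'rV[R]_n -> 'rV[R]_n) y a :
  (forall i, differentiable (fun z => f z 0 i) y) ->
  differentiable f y /\ 'D_a f y = \row_i 'D_a (fun z => f z 0 i) y.
Proof.
move=> df; split.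
  have -> : f = \sum_i (fun z => f z 0 i *: delta_mx 0 i).
    apply/funext => z; rewrite fct_sumE [LHS]row_sum_delta.
    by [].
  by apply: differentiable_sum => i; exact: differentiableZl.
rewrite derive_mx; first by apply/matrixP => i j; rewrite !mxE ord1.
by apply/derivable_mxP => i j; rewrite ord1; exact: diff_derivable.
Qed.

(** The chain rule for the transition map [t]; on functions that are not smooth near [x] both sides
    are 0 by convention. *)
Lemma chart_tvec_change c c' x a : atlas c -> atlas c' -> cdom c x -> cdom c' x ->
  chart_tvec c' x a =
  chart_tvec c x ('D_a (fun y => cmap c (cinv c' y)) (cmap c' x)) :> tvec M.
Proof.
move=> ac ac' dx dx'; apply/funext => f; rewrite /chart_tvec.
case: asboolP => // sf.
have [od _ _ _ K] := atlas_chart ac; have [od' _ _ _ K'] := atlas_chart ac'.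
set t := fun y => _.
have [dt _] : differentiable t (cmap c' x) /\ 'D_a t (cmap c' x) = \row_i 'D_a (fun z => t z 0 i) (cmap c' x).
  by apply: deriveMx_rv => i; exact: (smooth_at_diff (f := chart_coord c i) ac' dx' (smooth_at_chart_coord i ac dx)).
have tx : t (cmap c' x) = cmap c x by rewrite /t K'.
have df := smooth_at_diff ac dx sf.
transitivity ('D_a ((f \o cinv c) \o t) (cmap c' x)).
  apply: near_eq_derive.
  have H : nbhs (cmap c' x) (cmap c' @` (cdom c' `&` cdom c)).
    by apply: open_nbhs_nbhs; split; [exact: chart_open|exists x].
  by apply: filterS H => y [z [dz' dz] <-] /=; rewrite /t K' // K.
rewrite deriveE; last by apply: differentiable_comp => //; rewrite tx.
rewrite diff_comp //= ?tx // deriveE //.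
by rewrite deriveE.
Qed.

Lemma chart_tvec_coord c x a i : atlas c -> cdom c x ->
  chart_tvec c x a (chart_coord c i) = a 0 i.
Proof.
move=> ac dx; rewrite /chart_tvec asboolT; last exact: smooth_at_chart_coord.
have [_ oi _ _ K] := atlas_chart ac.
rewrite (near_eq_derive (g := fun z : 'rV[R]_n => z 0 i)); last first.
  have H : nbhs (cmap c x) (cmap c @` cdom c) by apply: open_nbhs_nbhs; split => //; exists x.
  by apply: filterS H => y [z dz <-] /=; rewrite /chart_coord K.
have := derive_mx (@derivable_id _ _ (cmap c x) a).
by rewrite derive_id => /matrixP /(_ 0 i); rewrite mxE.
Qed.

Definition chart_vec (c : chart R n M) (v : tvec M) : 'rV[R]_n := \row_i v (chart_coord c i).

(** [tangent] only provides some chart; this moves a tangent vector into a chosen one, where its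
    coordinates are its values on the coordinate functions. *)
Lemma tangent_chart c x v : atlas c -> cdom c x -> tangent x v ->
  v = chart_tvec c x (chart_vec c v).
Proof.
move=> ac dx [c' [a [ac' dx' ->]]]; rewrite (chart_tvec_change a ac ac' dx dx').
congr (chart_tvec _ _ _); apply/rowP => i.
by rewrite mxE chart_tvec_coord.
Qed.

Lemma chart_tvec_lin c x k a b : atlas c -> cdom c x ->
  chart_tvec c x (k *: a + b) = k *: chart_tvec c x a + chart_tvec c x b :> tvec M.
Proof.
move=> ac dx; apply/funext => f; rewrite /chart_tvec !fctE /=.
case: asboolP => [sf|_]; last by rewrite scaler0 addr0.
have df := smooth_at_diff ac dx sf.
by rewrite !deriveE // linearP.
Qed.

Section TangentVector.
Variables (x : M) (v : tvec M).
Hypothesis tv : tangent x v.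

(** Being smooth near [x] depends only on the germ, so the extension by 0 does not spoil
    locality. *)
Lemma tv_near f g : {near x, f =1 g} -> v f = v g.
Proof.
move=> fg; case: tv => c [a [ac dx ->]]; rewrite /chart_tvec.
have -> : smooth_at x f = smooth_at x g.
  apply/propext; split; apply: smooth_at_near => //.
  by apply: filterS fg => z ->.
case: asboolP => // sg; apply: near_eq_derive.
have [_ oi _ ci K] := atlas_chart ac.
have cx : (cmap c @` cdom c) (cmap c x) by exists x.
have cix : {for cmap c x, continuous (cinv c)}.
  by move: ci; rewrite continuous_open_subspace // => /(_ (cmap c x)); apply; rewrite inE.
have H : \forall z \near cinv c (cmap c x), f z = g z by rewrite K.
exact: (cix _ H).
Qed.

Lemma tvcst (k : R) : v (fun=> k) = 0.
Proof.
case: tv => c [a [ac dx ->]]; rewrite /chart_tvec asboolT.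
  by rewrite [X in 'D_a X _](_ : _ = cst k) // derive_cst.
exact: smooth_at_cst.
Qed.

Lemma tvD f g : smooth_at x f -> smooth_at x g -> v (fun y => f y + g y) = v f + v g.
Proof.
move=> sf sg; have sfg := smooth_atD sf sg.
case: tv => c [a [ac dx ->]]; rewrite /chart_tvec !asboolT //.
by rewrite -(@deriveD _ _ _ (f \o cinv c) (g \o cinv c)) //; apply: diff_derivable; exact: smooth_at_diff.
Qed.

Lemma tvM f g : smooth_at x f -> smooth_at x g -> v (fun y => f y * g y) = v f * g x + f x * v g.
Proof.
move=> sf sg; have sfg := smooth_atM sf sg.
case: tv => c [a [ac dx ->]]; rewrite /chart_tvec !asboolT //.
have [_ _ _ _ K] := atlas_chart ac.
rewrite [LHS](@deriveM _ _ (f \o cinv c) (g \o cinv c)); first last.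
- by apply: diff_derivable; exact: smooth_at_diff.
- by apply: diff_derivable; exact: smooth_at_diff.
by rewrite /= K // addrC; congr (_ + _); rewrite mulrC.
Qed.

Lemma tvZ (k : R) f : smooth_at x f -> v (fun y => k * f y) = k * v f.
Proof.
move=> sf; rewrite (@tvM (fun=> k)) ?tvcst ?mul0r ?add0r //; exact: smooth_at_cst.
Qed.

End TangentVector.

End SmoothM.

(** * Frames adapted to the filtration *)

Section AdaptedFrame.
Context {R : realType} {n : nat} {M : manifold R n} (T : filtration M).
Implicit Types (U V : set M) (f g : M -> R).

Lemma fsub_mono i j (x : M) : (i <= j)%N -> T i x `<=` T j x.
Proof.
elim: j => [|j IH]; first by rewrite leqn0 => /eqP ->.
by rewrite leq_eqVlt => /predU1P[->//|/IH H]; apply: subset_trans H _; exact: fsubS.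
Qed.

Lemma fsub_tangent j (x : M) : T j x `<=` tangent x.
Proof.
rewrite -(@fsub_top _ _ _ T (maxn j (fdepth T)) x) ?leq_maxr //.
by apply: fsub_mono; rewrite leq_maxl.
Qed.

Lemma fsub_lin j (x : M) (k : R) v w : T j x v -> T j x w -> T j x (k *: v + w).
Proof.
have [U [d [Z [[_ Ux] _ /(_ x Ux) [H _]]]]] := fsub_subbundle T j x.
move=> /H [a /= /subr0_eq ->] /H [b /= /subr0_eq ->]; apply/H; exists (k *: a + b) => /=.
rewrite scaler_sumr -big_split /= [X in _ - X](eq_bigr (fun i => k *: (a 0 i *: Z i x) + b 0 i *: Z i x)) ?subrr //.
by move=> i _; rewrite !mxE scalerDl scalerA.
Qed.

Lemma fsub_0 j (x : M) : T j x 0.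
Proof. by apply: (fsub_mono (leq0n j)); rewrite fsub0. Qed.

Lemma fsub_sum j (x : M) m (k : 'I_m -> R) (Z : 'I_m -> tvec M) :
  (forall i, T j x (Z i)) -> T j x (\sum_i k i *: Z i).
Proof.
move=> H; elim/big_ind : _; [exact: fsub_0| |].
  by move=> v w Hv Hw; rewrite -[v]scale1r; exact: fsub_lin.
by move=> i _; rewrite -[_ *: _]addr0; apply: fsub_lin => //; exact: fsub_0.
Qed.

Lemma tvec_sumE m (k : 'I_m -> R) (Z : 'I_m -> tvec M) (f : M -> R) :
  (\sum_i k i *: Z i) f = \sum_i k i * Z i f.
Proof. by rewrite fct_sumE. Qed.

Lemma fsection_sub j U V X : V `<=` U -> fsection T j U X -> fsection T j V X.
Proof.
move=> VU [[tX sX] fX]; split; last by move=> x /VU; exact: fX.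
split; first by move=> x /VU; exact: tX.
by move=> W f oW WV; apply: sX => //; exact: subset_trans VU.
Qed.

Lemma fsection_smooth j U V X f : open V -> V `<=` U -> fsection T j U X ->
  smooth V f -> smooth V (fun y => X y f).
Proof. by move=> oV VU [[_ sX] _]; exact: sX. Qed.

Lemma fsection_tangent j U X x : fsection T j U X -> U x -> tangent x (X x).
Proof. by move=> [[tX _] _]; exact: tX. Qed.

Definition frame_mx (c : chart R n M) N (X : 'I_N -> vfield M) (x : M) : 'M[R]_(N, n) :=
  \matrix_(a, i) X a x (chart_coord c i).

Definition comb N (k : 'rV[R]_N) (X : 'I_N -> vfield M) (x : M) : tvec M :=
  \sum_a k 0 a *: X a x.

Lemma chart_tvec0 (c : chart R n M) x : atlas c -> cdom c x -> chart_tvec c x 0 = 0 :> tvec M.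
Proof.
move=> ac dx; have := chart_tvec_lin (-1) 0 0 ac dx.
by rewrite scaler0 addr0 scaleN1r addNr.
Qed.

Lemma comb_chart c N (k : 'rV[R]_N) (X : 'I_N -> vfield M) (x : M) : atlas c -> cdom c x ->
  (forall a, tangent x (X a x)) -> comb k X x = chart_tvec c x (k *m frame_mx c X x).
Proof.
move=> ac dx tX; rewrite mulmx_sum_row /comb.
have := chart_tvec0 ac dx => c0.
elim/big_rec2 : _ => // a v w _ ->; rewrite chart_tvec_lin //; congr (_ *: _ + _).
rewrite [LHS](tangent_chart ac dx) //; congr (chart_tvec _ _ _).
by apply/rowP => i; rewrite !mxE.
Qed.

Lemma comb_chart_vec c N (k : 'rV[R]_N) (X : 'I_N -> vfield M) (x : M) :
  chart_vec c (comb k X x) = k *m frame_mx c X x.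
Proof.
by apply/rowP => i; rewrite !mxE /comb tvec_sumE; apply: eq_bigr => a _; rewrite mxE.
Qed.

Lemma near_unitmx U p (A : M -> 'M[R]_p) x0 : open U -> U x0 ->
  (forall i j, smooth U (fun x => A x i j)) -> A x0 \in unitmx ->
  exists V, [/\ open_nbhs x0 V, V `<=` U & forall x, V x -> A x \in unitmx].
Proof.
move=> oU Ux sA; rewrite unitmxE unitfE => d0.
have cd : continuous_at x0 (fun x => \det (A x)).
  by apply: (smooth_continuous oU Ux); exact: smooth_det.
have : \forall x \near x0, \det (A x) != 0 by apply: cvgr_neq0 cd d0.
rewrite /prop_near1 nbhsE => -[V [oV Vx] H]; exists (V `&` U); split.
- by split; [exact: openI|].
- exact: subIsetr.
- by move=> x [/H Vx' _]; rewrite unitmxE unitfE.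
Qed.

Lemma smooth_frame_mx U c N (X : 'I_N -> vfield M) : open U -> atlas c -> U `<=` cdom c ->
  (forall a, smooth_vfield U (X a)) -> forall a i, smooth U (fun x => frame_mx c X x a i).
Proof.
move=> oU ac Uc sX a i.
apply: (smooth_ext (f := fun x => X a x (chart_coord c i))) => // [x _|]; first by rewrite mxE.
by apply: (sX a).2 => //; apply: smoothS (smooth_chart_coord _ ac).
Qed.

Lemma row_free_compl m d (A : 'M[R]_(m, d)) : row_free A ->
  exists p (C : 'M[R]_(p, d)), (m + p)%N = d /\ row_free (col_mx A C).
Proof.
move=> fA; exists (\rank A^C)%MS, (row_base A^C)%MS.
have e : (m + \rank A^C)%N = d.
  by rewrite mxrank_compl (eqP fA) subnKC // -(eqP fA) rank_leq_col.
split => //; rewrite /row_free -addsmxE.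
have -> : \rank (A + row_base A^C)%MS = \rank (A + A^C)%MS.
  by rewrite (adds_eqmx (eqmx_refl A) (eq_row_base _)).
by rewrite (eqP (addsmx_compl_full A)) e.
Qed.

Lemma frame_row_free c N (Z : 'I_N -> vfield M) (x : M) S : atlas c -> cdom c x ->
  (forall a, tangent x (Z a x)) ->
  is_basis_mod S [set 0] (fun i => Z i x) -> row_free (frame_mx c Z x).
Proof.
move=> ac dx tZ [_ H]; rewrite -kermx_eq0; apply/eqP/row_matrixP => i; rewrite row0.
apply: H => /=; rewrite -/(comb _ _ _) (comb_chart _ ac dx) //.
by rewrite -row_mul mulmx_ker row0 chart_tvec0.
Qed.

(* Unlike in [adapted_frame], only the T^{-i}M with [i <= j] have to be spanned, so
   that frames can be built by induction on [j]. *)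
Definition pre_adapted (c : chart R n M) (x0 : M) (j : nat) U N (o : 'I_N -> nat)
    (X : 'I_N -> vfield M) : Prop :=
  [/\ open_nbhs x0 U /\ U `<=` cdom c,
      forall a, (0 < o a <= j)%N /\ fsection T (o a) U (X a),
      row_free (frame_mx c X x0) &
      forall i x v, (i <= j)%N -> U x -> T i x v ->
        exists2 k : 'rV[R]_N, (forall a, ~~ (o a <= i)%N -> k 0 a = 0) & v = comb k X x].

(** Induction on [j]. The frame found so far is independent at [x0], so its coefficient matrix [G0]
    in a local frame [Z] of T^{-(j+1)}M can be completed by constant rows [C]; the new fields are
    the corresponding constant combinations of [Z]. Independence at [x0] persists nearby. *)
Lemma pre_adapted_exists c x0 j : atlas c -> cdom c x0 ->
  exists U N (o : 'I_N -> nat) X, pre_adapted c x0 j U o X.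
Proof.
move=> ac dx; have [od _ _ _ _] := atlas_chart ac.
elim: j => [|j IH]; last have [U [N [ o [X [[[oU Ux] Uc] HX fX sX]]]]] := IH.
  exists (cdom c), 0%N, (fun=> 0%N), (fun=> 0); split => //.
  - by split=> //; split.
  - by move=> [].
  - by rewrite /row_free -leqn0 rank_leq_row.
  - move=> i x v; rewrite leqn0 => /eqP -> _; rewrite fsub0 => /= ->.
    by exists 0 => //; rewrite /comb big_ord0.
have [U' [d [Z [[oU' Ux'] sZ bZ]]]] := fsub_subbundle T j.+1 x0.
have tZ x a : U' x -> tangent x (Z a x) by move=> /(sZ a).1.
have TZ x a : U' x -> T j.+1 x (Z a x).
  move=> /bZ [H _]; apply/H; exists (delta_mx 0 a) => /=.
  rewrite (bigD1 a) //= big1 ?addr0 ?mxE ?eqxx ?scale1r ?subrr //.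
  by move=> b ba; rewrite mxE (negbTE ba) scale0r.
have span x v : U' x -> T j.+1 x v -> exists k, v = comb k Z x.
  by move=> /bZ [H _] /H [k /= /subr0_eq ->]; exists k.
have fZ x : U' x -> cdom c x -> row_free (frame_mx c Z x).
  by move=> U'x dx'; apply: (frame_row_free ac dx' _ (bZ _ U'x)) => a; exact: tZ.
have spanX m (Y : 'I_m -> vfield M) x : U' x -> (forall a, T j.+1 x (Y a x)) ->
    exists G : 'M[R]_(m, d), frame_mx c Y x = G *m frame_mx c Z x /\ forall a, Y a x = comb (row a G) Z x.
  move=> U'x TY; have /choice[g gP] : forall a, exists k, Y a x = comb k Z x.
    by move=> a; exact: span.
  have HG a : Y a x = comb (row a (\matrix_a g a)) Z x by rewrite rowK.
  exists (\matrix_a g a); split=> //; apply/row_matrixP => a; rewrite row_mul -comb_chart_vec -HG.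
  by apply/rowP => i; rewrite !mxE.
have [G0 [G0E _]] := spanX _ X x0 Ux' (fun a => fsub_mono (leqW (andP (HX a).1).2) ((HX a).2.2 _ Ux)).
have fG0 : row_free G0.
  by move: fX; rewrite G0E /row_free mxrankMfree //; exact: fZ.
have [p [C [e fC]]] := row_free_compl fG0; subst d.
pose W (b : 'I_p) : vfield M := fun x => comb (row b C) Z x.
pose X' (a : 'I_(N + p)) : vfield M := match fintype.split a with inl a => X a | inr b => W b end.
pose o' (a : 'I_(N + p)) : nat := match fintype.split a with inl a => o a | inr b => j.+1 end.
have WE x : frame_mx c W x = C *m frame_mx c Z x.
  by apply/row_matrixP => a; rewrite row_mul -comb_chart_vec; apply/rowP => i; rewrite !mxE.
have X'E x : frame_mx c X' x = col_mx (frame_mx c X x) (frame_mx c W x).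
  by apply/matrixP => a i; rewrite !mxE /X'; case: fintype.split => b; rewrite !mxE.
have sW b : fsection T j.+1 U' (W b).
  split; last by move=> x U'x; apply: fsub_sum => a; exact: TZ.
  split; first by move=> x U'x; apply: (@fsub_tangent j.+1); apply: fsub_sum => a; exact: TZ.
  move=> V f oV VU sf; apply: (smooth_ext (f := fun x => \sum_a (row b C) 0 a * Z a x f)) => //.
    by move=> x _; rewrite /W /comb tvec_sumE.
  by apply: smooth_sum => // a _; apply: smoothZ => //; exact: (sZ a).2.
have fX'0 : row_free (frame_mx c X' x0).
  by rewrite X'E G0E WE -mul_col_mx /row_free mxrankMfree //; exact: fZ.
have sX' a : (0 < o' a <= j.+1)%N /\ fsection T (o' a) (U `&` U') (X' a).
  rewrite /o' /X'; case: fintype.split => b.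
    have [/andP[-> /leqW ->] H] := HX b; split=> //.
    by apply: fsection_sub H; exact: subIsetl.
  by rewrite /= leqnn; split=> //; apply: fsection_sub (sW b); exact: subIsetr.
have /row_freeP[B X'B] := fX'0.
have [V [[oV Vx] VU uV]] : exists V, [/\ open_nbhs x0 V, V `<=` U `&` U' & forall x, V x -> frame_mx c X' x *m B \in unitmx].
  apply: near_unitmx; [exact: openI|by []| |by rewrite X'B unitmx1].
  apply: smooth_mulmx; [exact: openI| |by move=> i k; apply: smooth_cst; exact: openI].
  apply: smooth_frame_mx => //; [exact: openI|by move=> x [/Uc]|].
  by move=> a; have [_ []] := sX' a.
exists V, (N + p)%N, o', X'; split => //.
- by split=> // x /VU[/Uc].
- by move=> a; have [? H] := sX' a; split=> //; exact: fsection_sub H.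
move=> i x v; rewrite leq_eqVlt => /predU1P[->|].
  move=> Vx' Tv; have [Ux1 U'x1] := VU _ Vx'.
  have [k ->] := span _ _ U'x1 Tv.
  have [G [GE Gc]] := spanX _ X' x U'x1 (fun a => fsub_mono (andP (sX' a).1).2 ((sX' a).2.2 _ (conj Ux1 U'x1))).
  (* By the choice of [p] the matrix [G] is square, and its product with the independent rows of [Z]
     has full rank near [x0]. Hence [Z] can be expressed in the new frame. *)
  have uG : G \in unitmx.
    rewrite -row_free_unit /row_free -(mxrankMfree G (fZ x U'x1 (Uc _ Ux1))) -GE.
    have := uV _ Vx'; rewrite -row_free_unit => /eqP H; rewrite eqn_leq rank_leq_row /=.
    by rewrite -[X in (X <= _)%N]H mxrankM_maxl.
  exists (k *m invmx G); first by move=> a; rewrite (andP (sX' a).1).2.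
  rewrite (comb_chart _ ac (Uc _ Ux1)); last by move=> a; exact: tZ.
  rewrite (comb_chart _ ac (Uc _ Ux1)); last by move=> a; apply: fsection_tangent (sX' a).2 _.
  by rewrite GE mulmxA mulmxKV.
rewrite ltnS => ij Vx' Tv; have [Ux1 U'x1] := VU _ Vx'.
have [k k0 ->] := sX i x v ij Ux1 Tv.
exists (row_mx k 0).
  move=> a; rewrite /o' mxE; case: fintype.split => b; first exact: k0.
  by rewrite mxE.
rewrite (comb_chart _ ac (Uc _ Ux1)); last by move=> a; apply: fsection_tangent (HX a).2 _.
rewrite (comb_chart _ ac (Uc _ Ux1)); last by move=> a; apply: fsection_tangent (sX' a).2 _.
by rewrite X'E mul_row_col mul0mx addr0.
Qed.

(* [ad_unit] says that the [X a x] are linearly independent; a constant [B] makes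
   the coefficients of a smooth section in the frame smooth, see [frame_coef]. *)
Record adapted_frame (c : chart R n M) U N (o : 'I_N -> nat) (X : 'I_N -> vfield M)
    (B : 'M[R]_(n, N)) : Prop := AdaptedFrame {
  ad_open : open U;
  ad_atlas : atlas c;
  ad_dom : U `<=` cdom c;
  ad_pos : forall a, (0 < o a)%N;
  ad_section : forall a, fsection T (o a) U (X a);
  ad_unit : forall x, U x -> frame_mx c X x *m B \in unitmx;
  ad_span : forall i x v, U x -> T i x v ->
    exists2 k : 'rV[R]_N, (forall a, ~~ (o a <= i)%N -> k 0 a = 0) & v = comb k X x
}.

Lemma adapted_frame_exists (x0 : M) :
  exists c U N (o : 'I_N -> nat) X B, U x0 /\ adapted_frame c U o X B.
Proof.
have [c ac dx] := atlas_cover x0.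
have [U [N [ o [X [[[oU Ux] Uc] HX fX sX]]]]] := pre_adapted_exists (fdepth T) ac dx.
have /row_freeP[B XB] := fX.
have [V [[oV Vx] VU uV]] : exists V, [/\ open_nbhs x0 V, V `<=` U & forall x, V x -> frame_mx c X x *m B \in unitmx].
  apply: near_unitmx => //; last by rewrite XB unitmx1.
  apply: smooth_mulmx => //; last by move=> i k; exact: smooth_cst.
  by apply: smooth_frame_mx => // a; have [_ []] := HX a.
exists c, V, N, o, X, B; split=> //; split => //.
- by move=> x /VU /Uc.
- by move=> a; have [/andP[]] := HX a.
- by move=> a; apply: fsection_sub (HX a).2.
move=> i x v Vx' Tv; have [ij|ij] := leqP i (fdepth T).
  by apply: sX => //; exact: VU.
(* Beyond the depth the filtration is constant and every letter has weight below [i], so no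
   coefficient has to vanish. *)
have Tv' : T (fdepth T) x v by rewrite fsub_top //; exact: fsub_tangent Tv.
have [k k0 ->] := sX _ _ _ (leqnn _) (VU _ Vx') Tv'.
exists k => // a; have [/andP[_ H] _] := HX a.
by rewrite (leq_trans H (ltnW ij)).
Qed.

Lemma adapted_frame_sub c U V N (o : 'I_N -> nat) X B : open V -> V `<=` U ->
  adapted_frame c U o X B -> adapted_frame c V o X B.
Proof.
move=> oV VU [H1 H2 H3 H4 H5 H6 H7]; split=> //.
- exact: subset_trans H3.
- by move=> a; apply: fsection_sub (H5 a).
- by move=> x /VU; exact: H6.
- by move=> i x v /VU; exact: H7.
Qed.

Section Coefs.
Context {c : chart R n M} {U : set M} {N : nat} {o : 'I_N -> nat} {X : 'I_N -> vfield M}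
  {B : 'M[R]_(n, N)} (ad : adapted_frame c U o X B).

Lemma ad_tangent a x : U x -> tangent x (X a x).
Proof. exact: fsection_tangent (ad_section ad a). Qed.

(** With F = [frame_mx c X x], the matrix B (F B)^-1 is a right inverse of F depending smoothly on
    [x]; it recovers k from the chart coordinates k F. F is not inverted itself, as its type does
    not make it square. *)
Definition frame_coef (v : tvec M) (x : M) : 'rV[R]_N := chart_vec c v *m B *m invmx (frame_mx c X x *m B).

Lemma frame_coef_comb x k : U x -> frame_coef (comb k X x) x = k.
Proof.
by move=> Ux; rewrite /frame_coef comb_chart_vec -(mulmxA k) mulmxK //; exact: (ad_unit ad).
Qed.

Lemma frame_coefE j x v : U x -> T j x v -> v = comb (frame_coef v x) X x.
Proof. by move=> Ux Tv; have [k k0 ->] := ad_span ad Ux Tv; rewrite frame_coef_comb. Qed.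

Lemma frame_coef0 j x v a : U x -> T j x v -> ~~ (o a <= j)%N -> frame_coef v x 0 a = 0.
Proof. by move=> Ux Tv; have [k k0 ->] := ad_span ad Ux Tv; rewrite frame_coef_comb // => /k0. Qed.

Lemma smooth_inv_frame_mx i j : smooth U (fun x => invmx (frame_mx c X x *m B) i j).
Proof.
apply: smooth_invmx; [exact: (ad_open ad)| |exact: (ad_unit ad)].
apply: smooth_mulmx; [exact: (ad_open ad)| |by move=> a b; apply: smooth_cst; exact: (ad_open ad)].
apply: smooth_frame_mx; [exact: (ad_open ad)|exact: (ad_atlas ad)|exact: (ad_dom ad)|].
by move=> a; have [] := ad_section ad a.
Qed.

Lemma smooth_frame_coef V Y a : open V -> V `<=` U -> smooth_vfield V Y ->
  smooth V (fun x => frame_coef (Y x) x 0 a).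
Proof.
move=> oV VU [tY sY]; apply: smooth_mulmx => //; last first.
  by move=> i j; apply: smoothS VU _; exact: smooth_inv_frame_mx.
apply: smooth_mulmx => //; last by move=> i j; exact: smooth_cst.
move=> i j; apply: (smooth_ext (f := fun x => Y x (chart_coord c j))) => //.
  by move=> x _; rewrite mxE.
by apply: sY => //; apply: smoothS (smooth_chart_coord _ (ad_atlas ad)); apply: subset_trans VU (ad_dom ad).
Qed.

End Coefs.

End AdaptedFrame.

(** * Ordered monomials in an adapted frame *)

Section Words.
Context {R : realType} {n : nat} {M : manifold R n} {T : filtration M}.
Context {N : nat} {o : 'I_N -> nat} {X : 'I_N -> vfield M}.

Definition word_op (w : seq 'I_N) (f : M -> R) : M -> R :=
  foldr (fun a g => fun x => X a x g) f w.

Definition wt (w : seq 'I_N) : nat := \sum_(a <- w) o a.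

Lemma wt_cons a w : wt (a :: w) = (o a + wt w)%N.
Proof. by rewrite /wt big_cons. Qed.

Lemma wt_perm u w : perm_eq u w -> wt u = wt w.
Proof. by move=> uw; exact: perm_big. Qed.

Definition sle : rel 'I_N := fun i j => (i <= j)%N.

Lemma sle_trans : transitive sle.
Proof. by move=> a b c; exact: leq_trans. Qed.

(* The span over C^oo(U) of the words satisfying [Q]; operators are only compared
   on germs of smooth functions at points of [U]. *)
Inductive opspan (U : set M) (Q : pred (seq 'I_N)) : ((M -> R) -> M -> R) -> Prop :=
| os0 : opspan U Q (fun f x => 0)
| osw w : Q w -> opspan U Q (word_op w)
| osD P1 P2 : opspan U Q P1 -> opspan U Q P2 -> opspan U Q (fun f x => P1 f x + P2 f x)
| osM a P : smooth U a -> opspan U Q P -> opspan U Q (fun f x => a x * P f x)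
| osE P P' : (forall f x, U x -> smooth_at x f -> P f x = P' f x) ->
    opspan U Q P -> opspan U Q P'.

Lemma os_bind U (Q Q' : pred (seq 'I_N)) P :
  (forall w, Q w -> opspan U Q' (word_op w)) -> opspan U Q P -> opspan U Q' P.
Proof.
move=> QQ'; elim=> {P} [|w Qw|P1 P2 _ H1 _ H2|a P sa _ H|P P' PP' _ H].
- exact: os0.
- exact: QQ'.
- exact: osD.
- exact: osM.
- exact: osE H.
Qed.

Lemma os_mono U (Q Q' : pred (seq 'I_N)) P :
  (forall w, Q w -> Q' w) -> opspan U Q P -> opspan U Q' P.
Proof. by move=> QQ'; apply: os_bind => w /QQ'; exact: osw. Qed.

Lemma os_sum U Q (I : Type) (r : seq I) (F : I -> (M -> R) -> M -> R) :
  (forall i, opspan U Q (F i)) -> opspan U Q (fun f x => \sum_(i <- r) F i f x).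
Proof.
move=> sF; elim: r => [|i r IH].
  by apply: osE (os0 U Q) => f x _ _; rewrite big_nil.
by apply: osE (osD (sF i) IH) => f x _ _; rewrite big_cons.
Qed.

(** * Rewriting operators in sorted words *)

Section FrameWords.
Context {c : chart R n M} {U : set M} {B : 'M[R]_(n, N)} (ad : adapted_frame T c U o X B).

Let oU : open U := ad_open ad.

Lemma frame_near x : U x -> \forall z \near x, U z.
Proof. by move=> Ux; apply: open_nbhs_nbhs. Qed.

Lemma smooth_X a V f : open V -> V `<=` U -> smooth V f -> smooth V (fun y => X a y f).
Proof. by move=> oV VU; apply: fsection_smooth (ad_section ad a). Qed.

Lemma smooth_at_X a x f : U x -> smooth_at x f -> smooth_at x (fun y => X a y f).
Proof.
move=> Ux [V [oV Vx] sf]; exists (U `&` V); first by split; [exact: openI|].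
by apply: smooth_X; [exact: openI|exact: subIsetl|exact: smoothS sf].
Qed.

Lemma smooth_word_op w V f : open V -> V `<=` U -> smooth V f -> smooth V (word_op w f).
Proof. by move=> oV VU sf; elim: w => // a w IH; exact: smooth_X. Qed.

Lemma smooth_at_word_op w x f : U x -> smooth_at x f -> smooth_at x (word_op w f).
Proof. by move=> Ux sf; elim: w => // a w IH; exact: smooth_at_X. Qed.

Lemma frame_field_near a x f g : U x -> {near x, f =1 g} -> X a x f = X a x g.
Proof. by move=> Ux; apply: tv_near; exact: (ad_tangent ad). Qed.

Lemma word_op_near w x f g : U x -> {near x, f =1 g} -> {near x, word_op w f =1 word_op w g}.
Proof.
move=> Ux fg; elim: w => //= a w IH.
have := near_join IH; have := frame_near Ux; apply: filterS2 => z Uz fgz.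
exact: frame_field_near.
Qed.

Lemma word_opD w x f g : U x -> smooth_at x f -> smooth_at x g ->
  word_op w (fun y => f y + g y) x = word_op w f x + word_op w g x.
Proof.
move=> Ux sf sg; elim: w x Ux sf sg => //= a w IH x Ux sf sg.
rewrite -(tvD (ad_tangent ad a Ux)); [|exact: smooth_at_word_op|exact: smooth_at_word_op].
apply: frame_field_near => //; have := smooth_near sg; have := smooth_near sf; have := frame_near Ux.
by apply: filterS3 => z; exact: IH.
Qed.

Lemma word_opZ w x k f : U x -> smooth_at x f -> word_op w (fun y => k * f y) x = k * word_op w f x.
Proof.
move=> Ux sf; elim: w x Ux sf => //= a w IH x Ux sf.
rewrite -(tvZ (ad_tangent ad a Ux)); last exact: smooth_at_word_op.
apply: frame_field_near => //; have := smooth_near sf; have := frame_near Ux.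
by apply: filterS2 => z; exact: IH.
Qed.

Lemma word_op0 w x : U x -> word_op w (fun=> 0) x = 0.
Proof.
move=> Ux; rewrite -[RHS](mul0r (word_op w (fun=> 0) x)) -(word_opZ w 0 Ux (smooth_at_cst x 0)).
by congr (word_op w _ x); apply/funext => y; rewrite mul0r.
Qed.

Lemma word_op_sum w x (I : Type) (r : seq I) (F : I -> M -> R) : U x ->
  (forall i, smooth_at x (F i)) ->
  word_op w (fun y => \sum_(i <- r) F i y) x = \sum_(i <- r) word_op w (F i) x.
Proof.
move=> Ux sF; elim: r => [|i r IH].
  by rewrite big_nil -[RHS](word_op0 w Ux); congr (word_op w _ x); apply/funext => y; rewrite big_nil.
rewrite big_cons -IH -word_opD //; last exact: smooth_at_sum.
by congr (word_op w _ x); apply/funext => y; rewrite big_cons.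
Qed.

Lemma os_smooth_at Q P x f : opspan U Q P -> U x -> smooth_at x f -> smooth_at x (P f).
Proof.
move=> osP; elim: osP x f => {P} [|w Qw|P1 P2 _ H1 _ H2|a P sa _ H|P P' PP' _ H] x f Ux sf.
- exact: smooth_at_cst.
- exact: smooth_at_word_op.
- by apply: smooth_atD; [exact: H1|exact: H2].
- by apply: smooth_atM; [exact: smooth_at_in sa|exact: H].
- apply: smooth_at_near (H x f Ux sf).
  by have := smooth_near sf; have := frame_near Ux; apply: filterS2 => z; exact: PP'.
Qed.

(** By the Leibniz rule a field applied to b times a word gives the longer word with coefficient b
    and the old word with coefficient X_a b; hence both words are required in the new span. *)
Lemma os_X (Q Q' : pred (seq 'I_N)) P a :
  (forall w, Q w -> opspan U Q' (word_op (a :: w)) /\ opspan U Q' (word_op w)) ->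
  opspan U Q P -> opspan U Q' (fun f x => X a x (P f)).
Proof.
move=> QQ'; elim=> {P} [|w Qw|P1 P2 O1 H1 O2 H2|b P sb O H|P P' PP' O H].
- by apply: osE (os0 U Q') => f x Ux _; rewrite (tvcst (ad_tangent ad a Ux)).
- by have [] := QQ' _ Qw.
- apply: osE (osD H1 H2) => f x Ux sf.
  by rewrite (tvD (ad_tangent ad a Ux)) //; apply: os_smooth_at; eassumption.
- have O' : opspan U Q' P by apply: os_bind O => w /QQ'[].
  apply: osE (osD (osM (smooth_X a oU (@subset_refl _ _) sb) O') (osM sb H)) => f x Ux sf.
  rewrite (tvM (ad_tangent ad a Ux)) //; first exact: smooth_at_in sb.
  by apply: os_smooth_at; eassumption.
- apply: osE H => f x Ux sf; apply: frame_field_near => //.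
  by have := smooth_near sf; have := frame_near Ux; apply: filterS2 => z; exact: PP'.
Qed.

Lemma fsection_lie a b : fsection T (o a + o b) U (lie (X a) (X b)).
Proof.
have [[sa Ta] [sb Tb]] := (ad_section ad a, ad_section ad b).
have H x : U x -> T (o a + o b)%N x (lie (X a) (X b) x) by apply: (@fsub_lie _ _ _ T _ _ U).
split=> //; split=> [x Ux|V f oV VU sf]; first exact: fsub_tangent (H _ Ux).
apply: (smooth_ext (f := fun x => X a x (fun y => X b y f) - X b x (fun y => X a y f))) => //.
  by move=> x Vx; rewrite /lie asboolT //; exact: smooth_at_in sf.
by apply: smoothB => //; do 2!apply: smooth_X => //.
Qed.

Definition bracket_coef a b (d : 'I_N) : M -> R := fun x => frame_coef (c := c) (X := X) (B := B) (lie (X a) (X b) x) x 0 d.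

Lemma smooth_bracket_coef a b d : smooth U (bracket_coef a b d).
Proof. by apply: (smooth_frame_coef ad) => //; case: (fsection_lie a b). Qed.

Lemma bracket_coef0 a b d x : U x -> ~~ (o d <= o a + o b)%N -> bracket_coef a b d x = 0.
Proof. by move=> Ux; apply: (frame_coef0 ad) => //; case: (fsection_lie a b) => _; exact. Qed.

Lemma bracketE a b x f : U x -> smooth_at x f ->
  X a x (fun y => X b y f) = X b x (fun y => X a y f) + \sum_d bracket_coef a b d x * X d x f.
Proof.
move=> Ux sf; apply/eqP; rewrite addrC -subr_eq; apply/eqP.
have : lie (X a) (X b) x f = X a x (fun y => X b y f) - X b x (fun y => X a y f).
  by rewrite /lie asboolT.
move=> <-; have [_ H] := fsection_lie a b.
by rewrite [in LHS](frame_coefE ad Ux (H _ Ux)) /comb tvec_sumE.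
Qed.

(** The bound [p] on the length drives the induction of the sorting argument, the bound [q] on the
    weight is what it is meant to preserve. *)
Definition spq (p q : nat) : pred (seq 'I_N) :=
  fun w => [&& sorted sle w, (size w <= p)%N & (wt w <= q)%N].

(* [X a, X b] is a combination of the [X d] with [o d <= o a + o b], so exchanging
   two letters creates shorter words of no larger weight. *)
Lemma pbw_step p v a : (size v <= p)%N -> sorted sle v ->
  exists u P, [/\ sorted sle u, perm_eq u (a :: v), opspan U (spq (size v) (o a + wt v)) P &
    forall f x, U x -> smooth_at x f -> word_op (a :: v) f x = word_op u f x + P f x].
Proof.
elim: p v a => [|p IH] [|b v] a //=.
1,2: by move=> _ _; exists [:: a], (fun f x => 0); split=> //; [exact: os0|move=> f x _ _; rewrite addr0].
rewrite ltnS => vp sv; have [ab|ba] := leqP a b.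
  exists (a :: b :: v), (fun f x => 0); split=> //; [|exact: os0|by move=> f x _ _; rewrite addr0].
  by rewrite /= /sle ab.
have sv' := path_sorted sv.
have [u [P [su pu sP PE]]] := IH v a vp sv'.
(* A letter put in front of a sorted word no longer than [v] can be sorted by the induction
   hypothesis. This serves both the error term of sorting [a] into [v] and the words produced by the
   bracket. *)
have ins w d : spq (size v) (o a + wt v) w \/ w = v ->
    (forall k, (o d + wt w <= k)%N -> opspan U (spq (size v).+1 k) (word_op (d :: w))).
  move=> Hw k wk; have [srt szw] : sorted sle w /\ (size w <= size v)%N.
    by case: Hw => [/and3P[]|->].
  have [u' [P' [su' pu' sP' PE']]] := IH w d (leq_trans szw vp) srt.
  have H1 : opspan U (spq (size v).+1 k) (word_op u').
    apply: osw; rewrite /spq su' (perm_size pu') /= ltnS szw (wt_perm pu') wt_cons.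
    by [].
  have H2 : opspan U (spq (size v).+1 k) P'.
    apply: os_mono sP' => z /and3P[sz zw wz]; rewrite /spq sz /=.
    by rewrite (leq_trans zw) ?(leq_trans szw) //= (leq_trans wz).
  by apply: osE (osD H1 H2) => f x Ux sf; rewrite PE'.
(* As [b] is below [a] and not above any letter of [v], it may stand in front of the sorted word
   [u]. The error consists of X_b applied to the earlier error and of the bracket of X_a and X_b
   applied to [v]. *)
exists (b :: u), (fun f x => X b x (P f) + \sum_d bracket_coef a b d x * word_op (d :: v) f x); split.
- rewrite /= path_sortedE //; last exact: sle_trans.
  rewrite su andbT (perm_all _ pu) /= {1}/sle (ltnW ba) /=.
  by move: sv; rewrite path_sortedE //; [case/andP|exact: sle_trans].
- by rewrite -(cat1s a) -(cat1s b v) perm_sym perm_catCA /= perm_cons perm_sym.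
- apply: osD; last first.
    apply: os_sum => d; have [od|od] := boolP (o d <= o a + o b)%N; last first.
      by apply: osE (os0 _ _) => f x Ux sf; rewrite bracket_coef0 // mul0r.
    apply: osM; first exact: smooth_bracket_coef.
    by apply: ins; [right|rewrite wt_cons; lia].
  apply: os_X sP => w Hw; split; last first.
    apply: osw; move: Hw; rewrite /spq => /and3P[-> Hs Hq] /=; rewrite wt_cons.
    by apply/andP; split; lia.
  apply: ins; first by left.
  by move: Hw => /and3P[_ _ Hq]; rewrite wt_cons; lia.
move=> f x Ux sf /=.
have sX := smooth_at_word_op v Ux sf.
rewrite bracketE // addrA; congr (_ + _).
rewrite -(tvD (ad_tangent ad b Ux)); [|exact: smooth_at_word_op|by apply: os_smooth_at; eassumption].
apply: frame_field_near => //; have := smooth_near sf; have := frame_near Ux.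
by apply: filterS2 => z; exact: PE.
Qed.

Lemma word_span w : opspan U (spq (size w) (wt w)) (word_op w).
Proof.
elim: w => [|a w IH]; first by apply: osw; rewrite /spq /= leqnn.
apply: os_X IH => w' /and3P[std_word' szw' ww'].
have [u [P [su pu sP PE]]] := pbw_step a (leqnn _) std_word'.
split; last by apply: osw; rewrite /spq std_word' /= wt_cons; apply/andP; split; lia.
have H1 : opspan U (spq (size w).+1 (o a + wt w)) (word_op u).
  by apply: osw; rewrite /spq su (perm_size pu) /= ltnS szw' (wt_perm pu) wt_cons leq_add2l.
have H2 : opspan U (spq (size w).+1 (o a + wt w)) P.
  apply: os_mono sP => z /and3P[sz zw wz]; rewrite /spq sz /=.
  by apply/andP; split; lia.
by rewrite wt_cons; apply: osE (osD H1 H2) => f x Ux sf; rewrite PE.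
Qed.

Definition std_word (q : nat) : pred (seq 'I_N) := fun w => sorted sle w && (wt w <= q)%N.

Lemma size_wt w : (size w <= wt w)%N.
Proof. by elim: w => // a w IH; rewrite wt_cons /=; have := ad_pos ad a; lia. Qed.

Lemma word_std_span w q : (wt w <= q)%N -> opspan U (std_word q) (word_op w).
Proof.
move=> wq; apply: os_mono (word_span w) => z /and3P[sz _ wz].
by rewrite /std_word sz (leq_trans wz).
Qed.

Lemma os_field q a P : opspan U (std_word q) P -> opspan U (std_word (o a + q)) (fun f x => X a x (P f)).
Proof.
apply: os_X => w /andP[sw1 wq]; split; apply: word_std_span; rewrite ?wt_cons; lia.
Qed.

Lemma os_word_op q w P : opspan U (std_word q) P -> opspan U (std_word (wt w + q)) (fun f => word_op w (P f)).
Proof.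
move=> sP; elim: w => [|a w IH]; first by rewrite /wt big_nil.
by rewrite wt_cons -addnA; exact: os_field.
Qed.

(** Here adaptedness of the frame enters: a section of T^{-j}M only involves letters of weight at
    most j, so expanding it does not raise the weight. *)
Lemma os_wmonomial V q P : open V -> U `<=` V -> wmonomial T V q P -> opspan U (std_word q) P.
Proof.
move=> oV UV; elim=> {q P} [|q a P sa _ H|q j Y P sY _ H].
- by apply: osE (osw _ (w := [::]) _) => //; rewrite /std_word /= /wt big_nil.
- by apply: osM => //; exact: smoothS sa.
have [[_ TY] sYU] := (sY, fsection_sub UV sY).
apply: (@osE _ _ (fun f x => \sum_d frame_coef (c := c) (X := X) (B := B) (Y x) x 0 d * X d x (P f))).
  move=> f x Ux sf.
  by rewrite [in RHS](frame_coefE ad Ux (TY _ (UV _ Ux))) /comb tvec_sumE.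
apply: os_sum => d; have [od|od] := boolP (o d <= j)%N; last first.
  apply: osE (os0 _ _) => f x Ux sf; rewrite (frame_coef0 ad Ux _ od) ?mul0r //.
  by apply: TY; exact: UV.
apply: osM; first by apply: (smooth_frame_coef ad) => //; case: sYU.
by apply: os_mono (os_field d H) => w /andP[sw1 wq]; rewrite /std_word sw1 /=; lia.
Qed.

(** A finite list, because letters have positive weight and so length is bounded by weight. *)
Definition std_words (q : nat) : seq (seq 'I_N) :=
  undup [seq w <- flatten [seq [seq val t | t <- enum {: k.-tuple 'I_N}] | k <- iota 0 q.+1] | std_word q w].

Lemma mem_std_words q w : (w \in std_words q) = std_word q w.
Proof.
rewrite mem_undup mem_filter; have [H|//] := boolP (std_word q w); apply/idP.
apply/flattenP; exists [seq val t | t <- enum {: (size w).-tuple 'I_N}].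
  apply/mapP; exists (size w) => //; rewrite mem_iota /= add0n ltnS.
  by move/andP: H => [_]; exact: leq_trans (size_wt w).
by apply/mapP; exists (in_tuple w) => //; rewrite mem_enum.
Qed.

Lemma uniq_std_words q : uniq (std_words q).
Proof. exact: undup_uniq. Qed.

Lemma os_coef q P : opspan U (std_word q) P -> exists b : seq 'I_N -> M -> R,
  (forall w, smooth U (b w)) /\
  forall f x, U x -> smooth_at x f -> P f x = \sum_(w <- std_words q) b w x * word_op w f x.
Proof.
elim=> {P} [|w Qw|P1 P2 _ [b1 [s1 E1]] _ [b2 [s2 E2]]|a P sa _ [b [sb E]]|P P' PP' _ [b [sb E]]].
- exists (fun _ _ => 0); split; first by move=> w; exact: smooth_cst.
  by move=> f x _ _; rewrite big1 // => w _; rewrite mul0r.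
- exists (fun v _ => (v == w)%:R); split; first by move=> v; exact: smooth_cst.
  move=> f x Ux sf; rewrite (bigD1_seq w) ?uniq_std_words ?mem_std_words //= eqxx mul1r big1 ?addr0 //.
  by move=> v /negbTE ->; rewrite mul0r.
- exists (fun w x => b1 w x + b2 w x); split; first by move=> w; exact: smoothD.
  move=> f x Ux sf; rewrite E1 // E2 // -big_split /=.
  by apply: eq_bigr => w _; rewrite mulrDl.
- exists (fun w x => a x * b w x); split; first by move=> w; exact: smoothM.
  by move=> f x Ux sf; rewrite E // mulr_sumr; apply: eq_bigr => w _; rewrite mulrA.
- by exists b; split=> // f x Ux sf; rewrite -PP' // E.
Qed.

End FrameWords.
End Words.

(** * Functions with prescribed derivatives at a point *)

Section Deletions.
Context {A : eqType}.
Implicit Types (b : A) (w u : seq A).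

(** One entry for each occurrence of [b], repetitions included: the Leibniz rule produces one term
    per occurrence. *)
Fixpoint dels b w : seq (seq A) :=
  if w is a :: w' then (if a == b then [:: w'] else [::]) ++ map (cons a) (dels b w')
  else [::].

Lemma mem_dels b w u : u \in dels b w -> perm_eq (b :: u) w.
Proof.
elim: w u => //= a w IH u; rewrite mem_cat => /orP[].
  by case: eqP => [->|//]; rewrite inE => /eqP ->.
case/mapP => v /IH vw ->.
by rewrite -(cat1s b) -(cat1s a v) perm_catCA /= perm_cons.
Qed.

Lemma dels_ex b w : b \in w -> exists u, u \in dels b w.
Proof.
elim: w => //= a w IH; rewrite inE eq_sym; case: eqP => [_ _|_ /= /IH[u uw]].
  by exists w; rewrite mem_cat inE eqxx.
by exists (a :: u); apply: map_f.
Qed.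

(* The derivative along [rev w] at [x0] of the product of the [ydual b], [b] in [s]:
   each factor has to be hit by exactly one letter (see [word_op_yprod]). *)
Fixpoint ndel (w : seq A) (s : seq A) : nat :=
  if s is b :: s' then \sum_(u <- dels b w) ndel u s' else 1.

(** Positivity permits division by [ndel]; its vanishing for words that are not permutations of each
    other makes products belonging to different sorted words independent. *)
Lemma ndel_gt0 w s : size w = size s -> (0 < ndel w s)%N = perm_eq w s.
Proof.
elim: s w => [|b s IH] w; first by move/size0nil ->.
move=> sz /=; apply/idP/idP.
  apply: contraTT => npm; rewrite -leqNgt leqn0; apply/eqP.
  rewrite big_seq big1 // => u /mem_dels uw; apply/eqP; rewrite -leqn0 leqNgt.
  rewrite IH; last by move: (perm_size uw); rewrite sz /= => -[].
  by apply: contra npm => us; rewrite perm_sym in uw; rewrite (permPl uw) perm_cons.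
move=> pm; have [u uw] : exists u, u \in dels b w.
  by apply: dels_ex; rewrite (perm_mem pm) mem_head.
rewrite (perm_big _ (perm_to_rem uw)) big_cons /= addn_gt0; apply/orP; left.
have := mem_dels uw => pu.
rewrite IH; last by move: (perm_size pu); rewrite sz /= => -[].
by rewrite -(perm_cons b) (permPl pu).
Qed.

End Deletions.

(** * Products of functions dual to the frame at a point *)

Section TestFunctions.
Context {R : realType} {n : nat} {M : manifold R n} {T : filtration M}.
Context {N : nat} {o : 'I_N -> nat} {X : 'I_N -> vfield M}.
Context {c : chart R n M} {U : set M} {B : 'M[R]_(n, N)} (ad : adapted_frame T c U o X B).
Variables (x0 : M) (Ux : U x0).

Let oU : open U := ad_open ad.
Notation Xw := (word_op (X := X)).

Lemma word_op_rcons w a f : Xw (rcons w a) f = Xw w (fun y => X a y f).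
Proof. by rewrite /word_op foldr_rcons. Qed.

Lemma smooth_XU a f : smooth U f -> smooth U (fun y => X a y f).
Proof. exact: (smooth_X ad a oU). Qed.

(** Vanishing to order [k] is measured by length and not by weight, since the Leibniz rule
    distributes letters. *)
Definition van k g := forall w, (size w < k)%N -> Xw w g x0 = 0.

Lemma van_X k g a : van k g -> van k.-1 (fun y => X a y g).
Proof. by move=> vg w wk; rewrite -word_op_rcons; apply: vg; rewrite size_rcons; lia. Qed.

Lemma word_op_Leibniz w a h g : smooth U h -> smooth U g ->
  Xw (rcons w a) (fun y => h y * g y) x0 =
  Xw w (fun y => X a y h * g y) x0 + Xw w (fun y => h y * X a y g) x0.
Proof.
move=> sh sg.
rewrite -(word_opD ad) //; last 2 first.
- by apply: smooth_at_in oU Ux _; apply: smoothM => //; exact: smooth_XU.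
- by apply: smooth_at_in oU Ux _; apply: smoothM => //; exact: smooth_XU.
rewrite word_op_rcons; apply: (nbhs_singleton (word_op_near ad w Ux _)).
apply: filterS (frame_near ad Ux) => z Uz.
by rewrite (tvM (ad_tangent ad a Uz)) //; exact: (smooth_at_in oU Uz).
Qed.

(** Any letter falling on [h] leaves fewer than [k] for [g]; only the term with all letters on [g]
    survives. *)
Lemma word_op_van w k h g : smooth U h -> smooth U g -> van k g -> (size w <= k)%N ->
  Xw w (fun y => h y * g y) x0 = h x0 * Xw w g x0.
Proof.
elim/last_ind: w k h g => [//|w a IH] k h g sh sg vg; rewrite size_rcons => wk.
rewrite word_op_Leibniz // (IH k) //; [|exact: smooth_XU|exact: ltnW].
rewrite vg // mulr0 add0r (IH k.-1) //; [by rewrite word_op_rcons|exact: smooth_XU|exact: van_X|lia].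
Qed.

(** An affine function of the chart coordinates that vanishes at [x0]; its linear part is a column
    of the right inverse of the frame matrix, so that its differential at [x0] is dual to the
    frame. *)
Definition ydual (b : 'I_N) : M -> R := fun y =>
  \sum_i (B *m invmx (frame_mx c X x0 *m B)) i b * (chart_coord c i y - chart_coord c i x0).

Lemma smooth_ydual b : smooth U (ydual b).
Proof.
apply: smooth_sum => // i _; apply: smoothZ => //; apply: smoothB => //.
  by apply: smoothS (smooth_chart_coord _ (ad_atlas ad)); exact: (ad_dom ad).
exact: smooth_cst.
Qed.

Lemma ydual0 b : ydual b x0 = 0.
Proof. by rewrite /ydual big1 // => i _; rewrite subrr mulr0. Qed.

Lemma X_ydual a b : X a x0 (ydual b) = (a == b)%:R.
Proof.
have sc i : smooth_at x0 (chart_coord c i).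
  by apply: smooth_at_chart_coord; [exact: (ad_atlas ad)|exact: (ad_dom ad)].
have H i : smooth_at x0 (fun y => (B *m invmx (frame_mx c X x0 *m B)) i b * (chart_coord c i y - chart_coord c i x0)).
  by apply: smooth_atM; [exact: smooth_at_cst|apply: smooth_atD => //; exact: smooth_at_cst].
have -> : X a x0 (ydual b) = \sum_i X a x0 (fun y =>
    (B *m invmx (frame_mx c X x0 *m B)) i b * (chart_coord c i y - chart_coord c i x0)).
  exact: (word_op_sum ad [:: a] (index_enum _) Ux H).
have /matrixP/(_ a b) : (frame_mx c X x0 *m (B *m invmx (frame_mx c X x0 *m B))) = 1%:M.
  by rewrite mulmxA mulmxV //; exact: (ad_unit ad).
rewrite [in RHS]mxE [in LHS]mxE => <-; apply: eq_bigr => i _.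
rewrite (tvZ (ad_tangent ad a Ux)); last by apply: smooth_atD => //; exact: smooth_at_cst.
rewrite (tvD (ad_tangent ad a Ux)) //; last exact: smooth_at_cst.
by rewrite (tvcst (ad_tangent ad a Ux)) addr0 mulrC [frame_mx _ _ _ _ _]mxE.
Qed.

(* As [ydual b] vanishes at [x0] and [g] vanishes there to order [k], exactly one of
   the [k.+1] letters has to hit [ydual b]. *)
Lemma word_op_ydual w k b g : smooth U g -> van k g -> size w = k.+1 ->
  Xw (rev w) (fun y => ydual b y * g y) x0 = \sum_(u <- dels b w) Xw (rev u) g x0.
Proof.
elim: w k g => [//|a w IH] k g sg vg /= [wk].
(* In the reversed word the head [a] is the innermost field, to which the Leibniz rule is applied,
   as in the recursion of [dels]. *)
rewrite rev_cons word_op_Leibniz //; last exact: smooth_ydual.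
rewrite (word_op_van (k := k)) //; [|exact/smooth_XU/smooth_ydual|by rewrite size_rev wk].
rewrite X_ydual big_cat; congr (_ + _).
  by case: eqP => _; rewrite ?big_nil ?big_seq1 ?mul1r ?mul0r.
rewrite big_map; case: k wk vg => [/size0nil ->|k wk vg].
  by rewrite /= big_nil /= ydual0 mul0r.
rewrite (IH k) //; [|exact: smooth_XU|exact: van_X vg].
by apply: eq_bigr => u _; rewrite rev_cons word_op_rcons.
Qed.

Definition yprod (s : seq 'I_N) : M -> R :=
  foldr (fun b g => fun y => ydual b y * g y) (fun=> 1) s.

Lemma smooth_yprod s : smooth U (yprod s).
Proof.
elim: s => [|b s IH]; first exact: smooth_cst.
by apply: smoothM => //; exact: smooth_ydual.
Qed.

Lemma van_yprod s : van (size s) (yprod s).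
Proof.
elim: s => [//|b s IH] w /=; rewrite ltnS => ws.
by rewrite (word_op_van (k := size s)) ?ydual0 ?mul0r //; [exact: smooth_ydual|exact: smooth_yprod].
Qed.

Lemma word_op_yprod w s : size w = size s -> Xw (rev w) (yprod s) x0 = (ndel w s)%:R.
Proof.
elim: s w => [|b s IH] w; first by move/size0nil ->.
move=> sz /=; rewrite (word_op_ydual b (smooth_yprod s) (@van_yprod s) sz).
rewrite natr_sum !big_seq; apply: eq_bigr => u /mem_dels/perm_size/= uw.
by apply: IH; move: uw; rewrite sz => -[].
Qed.

(** Induction on the length. Products of k dual functions vanish to order k, so they correct the
    values of the words of length k without disturbing shorter ones; on sorted words of length k
    they form a diagonal system. *)
Lemma test_fun (k : nat) (t : seq 'I_N -> R) : exists2 f, smooth U f &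
  forall v, sorted sle v -> (size v < k)%N -> Xw v f x0 = t v.
Proof.
elim: k => [|k [f sf Hf]]; first by exists (fun=> 0); first exact: smooth_cst.
pose L := undup [seq w <- [seq val t | t <- enum {: k.-tuple 'I_N}] | sorted sle w].
have memL w : (w \in L) = (sorted sle w && (size w == k)).
  rewrite mem_undup mem_filter; case: (sorted sle w) => //=.
  apply/mapP/eqP => [[u _ ->]|<-]; first by rewrite size_tuple.
  by exists (in_tuple w) => //; rewrite mem_enum.
(* The value still missing at [s], divided by the derivative of [yprod s] along [s] itself. *)
pose h (s : seq 'I_N) := fun y => (t s - Xw s f x0) / (ndel (rev s) s)%:R * yprod s y.
have sh s : smooth U (h s) by apply: smoothZ => //; exact: smooth_yprod.
exists (fun y => f y + \sum_(s <- L) h s y).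
  by apply: smoothD => //; apply: smooth_sum.
move=> v sv; rewrite ltnS => vk.
have sat g : smooth U g -> smooth_at x0 g by exact: smooth_at_in.
rewrite (word_opD ad) //; [|exact: sat|by apply: sat; exact: smooth_sum].
rewrite (word_op_sum ad _ _ Ux) //; last by move=> s; exact: sat.
have hE s : Xw v (h s) x0 = (t s - Xw s f x0) / (ndel (rev s) s)%:R * Xw v (yprod s) x0.
  by rewrite (word_opZ ad) //; apply: sat; exact: smooth_yprod.
under eq_bigr do rewrite hE.
move: vk; rewrite leq_eqVlt => /predU1P[vk|vk]; last first.
  rewrite big_seq big1 ?addr0 ?Hf // => s; rewrite memL => /andP[_ /eqP sk].
  by rewrite van_yprod ?mulr0 // sk.
rewrite (bigD1_seq v) ?undup_uniq //=; last by rewrite memL sv vk eqxx.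
rewrite big_seq_cond big1 ?addr0; last first.
  move=> s; rewrite memL => /andP[/andP[ss /eqP sk] sv'].
  rewrite -(revK v) word_op_yprod; last by rewrite size_rev vk sk.
  (* Sorted words that are permutations of each other coincide, so off the diagonal the derivative
     is 0. *)
  have : ~~ (0 < ndel (rev v) s)%N.
    rewrite ndel_gt0; last by rewrite size_rev vk sk.
    apply: contra sv' => pm; rewrite eq_sym; apply/eqP.
    apply: (sorted_eq sle_trans) => //; last first.
      by apply: perm_trans pm; rewrite perm_sym perm_rev.
    by move=> i j; rewrite /sle -eqn_leq => /eqP/val_inj.
  by rewrite -leqNgt leqn0 => /eqP ->; rewrite mulr0.
have -> : Xw v (yprod v) x0 = (ndel (rev v) v)%:R.
  by rewrite -{1}(revK v) word_op_yprod // size_rev.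
have d0 : (ndel (rev v) v)%:R != 0 :> R.
  by rewrite pnatr_eq0 -lt0n ndel_gt0 ?size_rev // perm_rev.
by rewrite divfK // addrC subrK.
Qed.

End TestFunctions.

(** * Coordinates on weighted jets *)

Section Sections.
Context {R : realType} {n : nat} {M : manifold R n} {E : vbundle M}.

Definition dual_frame (V0 : set M) (e : 'I_(vrank E) -> section E)
    (lam : forall x, 'I_(vrank E) -> {scalar E x}) : Prop :=
  forall x, V0 x -> (forall i j, lam x i (e j x) = (i == j)%:R) /\
    forall v, v = \sum_i lam x i v *: e i x.

(** Coefficients in a basis are unique, hence linear; outside [V0] the forms are arbitrary. *)
Lemma dual_frame_exists V0 (e : 'I_(vrank E) -> section E) : frames (V0, e) ->
  exists lam, dual_frame V0 e lam.
Proof.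
move=> fe; suff H x : exists lam : 'I_(vrank E) -> {scalar E x}, V0 x ->
    (forall i j, lam i (e j x) = (i == j)%:R) /\ forall v, v = \sum_i lam i v *: e i x.
  by exists (fun x => projT1 (cid (H x))) => x; exact: (projT2 (cid (H x))).
have [V0x|nV0] := pselect (V0 x); last by exists (fun=> \0) => /nV0.
have [_ /(_ _ V0x)[sp fr]] := frames_basis fe.
have /choice[g gP] : forall v, exists c : 'rV_(vrank E), v = \sum_i c 0 i *: e i x.
  by move=> v; have /sp[k /= /subr0_eq] : setT v by []; exists k.
have gU v (c : 'rV[R]_(vrank E)) : v = \sum_i c 0 i *: e i x -> g v = c.
  move=> vE; apply/subr0_eq/fr => /=.
  rewrite (eq_bigr (fun i => g v 0 i *: e i x - c 0 i *: e i x)); last first.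
    by move=> i _; rewrite !mxE scalerBl.
  by rewrite sumrB -gP -vE subrr.
have gl i : scalar (fun v => g v 0 i).
  move=> a u v; rewrite (gU _ (a *: g u + g v)) ?mxE //.
  rewrite {1}(gP u) {1}(gP v) scaler_sumr -big_split; apply: eq_bigr => j _ /=.
  by rewrite !mxE scalerDl scalerA.
pose L i := GRing.isLinear.Build R (E x) R *%R (fun v => g v 0 i) (gl i).
pose lam i : {scalar E x} := HB.pack (fun v => g v 0 i) (L i).
exists lam => _; split; last exact: gP.
move=> i j; have -> : lam i (e j x) = g (e j x) 0 i by [].
rewrite (gU _ (delta_mx 0 j)) ?mxE //.
rewrite (bigD1 j) //= big1 ?addr0 ?mxE ?eqxx ?scale1r //.
by move=> k kj; rewrite mxE (negbTE kj) scale0r.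
Qed.

Lemma sectionD (s t : section E) x : (s + t) x = s x + t x. Proof. by []. Qed.
Lemma sectionZ (a : R) (s : section E) x : (a *: s) x = a *: s x. Proof. by []. Qed.
Lemma section0 x : (0 : section E) x = 0. Proof. by []. Qed.

Lemma smooth_section_sub U V (s : section E) : V `<=` U -> smooth_section U s ->
  smooth_section V s.
Proof.
move=> VU ss W e fe; have [k [sk E1]] := ss _ _ fe; exists k; split.
  by move=> i; apply: smoothS (sk i) => x [/VU].
by move=> x [/VU Ux Wx]; exact: E1.
Qed.

Lemma smooth_section_lin U (a : R) (s t : section E) : open U ->
  smooth_section U s -> smooth_section U t -> smooth_section U (a *: s + t).
Proof.
move=> oU ss st W e fe; have [k [sk E1]] := ss _ _ fe; have [l [sl E2]] := st _ _ fe.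
have oUW : open (U `&` W) by apply: openI => //; case: (frames_basis fe).
exists (fun i x => a * k i x + l i x); split.
  by move=> i; apply: smoothD => //; exact: smoothZ.
move=> x UWx; rewrite sectionD sectionZ E1 // E2 // scaler_sumr -big_split.
by apply: eq_bigr => i _ /=; rewrite scalerDl scalerA.
Qed.

Lemma smooth_section_at_lin x (a : R) (s t : section E) :
  smooth_section_at x s -> smooth_section_at x t -> smooth_section_at x (a *: s + t).
Proof.
move=> [U [oU Ux] ss] [V [oV Vx] st]; exists (U `&` V); first by split; [exact: openI|].
apply: smooth_section_lin; [exact: openI|exact: smooth_section_sub ss|exact: smooth_section_sub st].
Qed.

Lemma smooth_section0 U : open U -> smooth_section U (0 : section E).
Proof.
move=> oU W e fe; exists (fun _ _ => 0); split.
  by move=> i; apply: smooth_cst; apply: openI => //; case: (frames_basis fe).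
by move=> x _; rewrite big1 // => i _; rewrite scale0r.
Qed.

Lemma smooth_section_at0 x : smooth_section_at x (0 : section E).
Proof. by exists setT; [split; [exact: openT|]|exact/smooth_section0/openT]. Qed.

Lemma smooth_section_atB x (s t : section E) :
  smooth_section_at x s -> smooth_section_at x t -> smooth_section_at x (s - t).
Proof.
move=> ss st; have := smooth_section_at_lin (-1) st ss.
by rewrite scaleN1r addrC.
Qed.

Lemma smooth_section_comb V0 (e : 'I_(vrank E) -> section E) U (k : 'I_(vrank E) -> M -> R) :
  frames (V0, e) -> open U -> U `<=` V0 -> (forall i, smooth U (k i)) ->
  smooth_section U (fun x => \sum_i k i x *: e i x).
Proof.
move=> fe oU UV0 sk W e' fe'; have [g [sg gE]] := frames_compat fe' fe.
have oUW : open (U `&` W) by apply: openI => //; case: (frames_basis fe').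
exists (fun i x => \sum_j k j x * g i j x); split.
  move=> i; apply: smooth_sum => // j _; apply: smoothM => //.
    by apply: smoothS (sk j); exact: subIsetl.
  by apply: smoothS (sg i j) => x [/UV0 ? ?].
move=> x [Ux Wx]; have Wx' : (W `&` V0) x by split=> //; exact: UV0.
rewrite (eq_bigr (fun j => \sum_i k j x *: (g i j x *: e' i x))); last first.
  by move=> j _; rewrite (gE _ Wx') scaler_sumr.
rewrite exchange_big /=; apply: eq_bigr => i _.
by rewrite scaler_suml; apply: eq_bigr => j _; rewrite scalerA.
Qed.

Section Coords.
Context {V0 : set M} {e : 'I_(vrank E) -> section E} (fe : frames (V0, e)).
Context {lam : forall x, 'I_(vrank E) -> {scalar E x}}.
Hypothesis lamP : dual_frame V0 e lam.

Definition coord (i : 'I_(vrank E)) (s : section E) : M -> R := fun x => lam x i (s x).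

Lemma coord_lin i a s t x : coord i (a *: s + t) x = a * coord i s x + coord i t x.
Proof. by rewrite /coord sectionD sectionZ linearP. Qed.

Lemma coord_comb i (k : 'I_(vrank E) -> M -> R) x : V0 x ->
  coord i (fun x => \sum_j k j x *: e j x) x = k i x.
Proof.
move=> V0x; rewrite /coord raddf_sum (bigD1 i) //= linearZ /= (lamP V0x).1 eqxx mulr1.
rewrite big1 ?addr0 // => j ji; rewrite linearZ /= (lamP V0x).1 eq_sym (negbTE ji).
by rewrite mulr0.
Qed.

Lemma coord_smooth i s U : open U -> U `<=` V0 -> smooth_section U s -> smooth U (coord i s).
Proof.
move=> oU UV ss; have [k [sk E1]] := ss _ _ fe.
have UE : U `&` V0 = U by apply/setIidPl.
rewrite UE in sk E1.
apply: (smooth_ext (f := k i)) => // x Ux.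
by rewrite -(coord_comb i k (UV _ Ux)) /coord E1.
Qed.

Let oV0 : open V0. Proof. by case: (frames_basis fe). Qed.

Lemma coord_smooth_at i s x : V0 x -> smooth_section_at x s -> smooth_at x (coord i s).
Proof.
move=> V0x [U [oU Ux] ss]; exists (U `&` V0); first by split; [exact: openI|].
apply: coord_smooth; [exact: openI|exact: subIsetr|].
by apply: smooth_section_sub ss; exact: subIsetl.
Qed.

End Coords.
End Sections.

Section OsMul.
Context {R : realType} {n : nat} {M : manifold R n} {T : filtration M}.
Context {N : nat} {o : 'I_N -> nat} {X : 'I_N -> vfield M}.
Context {c : chart R n M} {U : set M} {B : 'M[R]_(n, N)} (ad : adapted_frame T c U o X B).

Let oU : open U := ad_open ad.
Notation Xw := (word_op (X := X)).

(** Multiplication by [a] has weight 0, so a word composed with it is again a combination of sorted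
    words of no larger weight. This reduces arbitrary sections of the dual bundle to a dual
    frame. *)
Lemma os_mul_eq0 r P a g x : opspan (X := X) U (std_word (o := o) r) P -> U x -> smooth U a ->
  smooth_at x g -> (forall w, std_word (o := o) r w -> Xw w g x = 0) ->
  P (fun y => a y * g y) x = 0.
Proof.
move=> sP Ux sa sg Hg.
have [b [sb ->]] := os_coef ad sP; [|by []|by apply: smooth_atM => //; exact: smooth_at_in sa].
rewrite big_seq big1 // => w; rewrite (mem_std_words ad) => /andP[_ wr].
have sid : opspan (X := X) U (std_word (o := o) 0) (fun f x => a x * f x).
  by apply: osM => //; apply: (@osw _ _ _ _ _ _ _ [::]); rewrite /std_word /= /wt big_nil.
have [b' [sb' E1]] := os_coef ad (os_word_op ad w sid).
rewrite (E1 g x Ux sg) big_seq big1 ?mulr0 // => v; rewrite (mem_std_words ad) addn0 => /andP[sv wv].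
by rewrite Hg ?mulr0 // /std_word sv (leq_trans wv).
Qed.

End OsMul.

(** * Equality of jets in terms of sorted words *)

Section JetChar.
Context {R : realType} {n : nat} {M : manifold R n} {T : filtration M}.
Context {N : nat} {o : 'I_N -> nat} {X : 'I_N -> vfield M}.
Context {c : chart R n M} {U : set M} {B : 'M[R]_(n, N)} (ad : adapted_frame T c U o X B).
Context {E : vbundle M}.
Context {V0 : set M} {e : 'I_(vrank E) -> section E} (fe : frames (V0, e)).
Context {lam : forall x, 'I_(vrank E) -> {scalar E x}}.
Hypothesis lamP : dual_frame V0 e lam.
Hypothesis UV0 : U `<=` V0.

Let oU : open U := ad_open ad.
Notation Xw := (word_op (X := X)).
Notation sc := (coord (lam := lam)).

Definition jet_zero (r : nat) (x : M) (s : section E) : Prop :=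
  forall w i, std_word (o := o) r w -> Xw w (sc i s) x = 0.

Lemma wmonomial_word_op w : wmonomial T U (wt (o := o) w) (Xw w).
Proof.
elim: w => [|a w IH]; first by rewrite /wt big_nil; exact: wmonomial_id.
by rewrite wt_cons; exact: (wmonomial_vfield (ad_section ad a) IH).
Qed.

(** The quantification over all operators and all dual sections reduces to finitely many conditions:
    an operator is a combination of sorted words, a dual section one of the dual frame, both with
    smooth coefficients. Conversely words and frame forms are admissible choices. *)
Lemma jet_equivP r x s t : U x -> smooth_section_at x s -> smooth_section_at x t ->
  jet_equiv T r x s t <-> jet_zero r x (s - t).
Proof.
move=> Ux ss st; split=> [H w i /andP[sww wr]|H U' P lam' oU' wP sl].
  apply: (H U (fun f => Xw w f) (fun y => lam y i)); first by split.
    move=> y Uy; exists U, 1%N, (fun=> wt (o := o) w), (fun=> Xw w); split=> //.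
      by move=> j; split=> //; exact: wmonomial_word_op.
    by move=> f z _ _; rewrite big_ord1.
  by move=> V u oV VU su; apply: (coord_smooth fe lamP) => //; exact: subset_trans VU UV0.
have [U'o U'x] := oU'.
have [V [m [q [Q [[oV Vx] HQ PE]]]]] := wP x U'x.
have [W1 [oW1 W1x] sW1] := smooth_section_atB ss st.
(* On this neighbourhood of [x] the frame, the dual section, the local form of the operator and the
   section are all available. *)
pose W := U `&` U' `&` V `&` W1.
have oW : open W by do !apply: openI => //.
have Wx : W x by [].
have WU : W `<=` U by move=> z [[[]]].
have WU' : W `<=` U' by move=> z [[[]]].
have WV : W `<=` V by move=> z [[]].
have WW1 : W `<=` W1 by move=> z [].
have WV0 := subset_trans WU UV0.
have adW := adapted_frame_sub oW WU ad.
pose f y := lam' y (s y - t y).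
pose h j y := lam' y (e j y).
have sh j : smooth W (h j).
  apply: sl => //.
  have -> : e j = (fun x => \sum_i (i == j)%:R *: e i x) :> section E.
    apply: functional_extensionality_dep => z.
    rewrite (bigD1 j) //= eqxx scale1r big1 ?addr0 // => i /negbTE ->.
    by rewrite scale0r.
  by apply: (smooth_section_comb fe) => // i; exact: smooth_cst.
have sg j : smooth W (sc j (s - t)).
  by apply: (coord_smooth fe lamP) => //; apply: smooth_section_sub sW1.
have fE : forall y, W y -> \sum_j h j y * sc j (s - t) y = f y.
  move=> y Wy; rewrite /f [in RHS]((lamP (WV0 _ Wy)).2 (s y - t y)) raddf_sum.
  by apply: eq_bigr => j _; rewrite /= linearZ /= mulrC.
have sf : smooth W f.
  by apply: smooth_ext fE _ => //; apply: smooth_sum => // j _; exact: smoothM.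
have satf := smooth_at_in oW Wx sf.
rewrite (PE f x Vx satf) big1 // => i _.
have [qi wQ] := HQ i.
have oQ := os_wmonomial adW oV WV wQ.
have [b [sb QE]] := os_coef adW oQ.
rewrite QE // big_seq big1 // => w; rewrite (mem_std_words ad) => /andP[sww wq].
have sat j : smooth_at x (fun y => h j y * sc j (s - t) y).
  by apply: (smooth_at_in oW Wx); apply: smoothM.
have -> : Xw w f x = Xw w (fun y => \sum_j h j y * sc j (s - t) y) x.
  apply: (nbhs_singleton (word_op_near ad w Ux _)).
  by apply: filterS (open_nbhs_nbhs (conj oW Wx)) => z Wz; rewrite fE.
rewrite (word_op_sum ad _ _ Ux sat) big1 ?mulr0 // => j _.
have oXw : opspan (X := X) W (std_word (o := o) r) (Xw w).
  by apply: osw; rewrite /std_word sww (leq_trans wq).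
apply: (os_mul_eq0 adW oXw Wx (sh j) (smooth_at_in oW Wx (sg j))) => v swv.
exact: H.
Qed.

Lemma jet_zero_lin r x a s t : U x -> smooth_section_at x s -> smooth_section_at x t ->
  jet_zero r x s -> jet_zero r x t -> jet_zero r x (a *: s + t).
Proof.
move=> Ux ss st zs zt w i sww.
have V0x := UV0 Ux.
have sas := coord_smooth_at fe lamP i V0x ss.
have sat := coord_smooth_at fe lamP i V0x st.
have -> : sc i (a *: s + t) = fun y => a * sc i s y + sc i t y.
  by apply/funext => y; rewrite coord_lin.
rewrite (word_opD ad) //; last by apply: smooth_atM => //; exact: smooth_at_cst.
by rewrite (word_opZ ad) // zs // zt // mulr0 addr0.
Qed.

Lemma jet_zero0 r x : U x -> jet_zero r x 0.
Proof.
move=> Ux w i _; rewrite -[RHS](word_op0 ad w Ux); congr (Xw w _ x).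
by apply/funext => y; rewrite /coord section0 linear0.
Qed.

Lemma jet_zero_sym r x s t : U x -> smooth_section_at x s -> smooth_section_at x t ->
  jet_zero r x (s - t) -> jet_zero r x (t - s).
Proof.
move=> Ux ss st z.
have := jet_zero_lin (-1) Ux (smooth_section_atB ss st) (smooth_section_at0 x) z (@jet_zero0 r x Ux).
by rewrite scaleN1r addr0 opprB.
Qed.

Lemma jet_eqP r x s t : U x -> smooth_section_at x s -> smooth_section_at x t ->
  jet T r x s = jet T r x t <-> jet_zero r x (s - t).
Proof.
move=> Ux ss st; split=> [H|z].
  have : jet T r x s t.
    rewrite H; split=> //; apply/jet_equivP => //.
    by rewrite subrr; exact: jet_zero0.
  by case=> _ /jet_equivP; exact.
have trans a b d : smooth_section_at x a -> smooth_section_at x b -> smooth_section_at x d ->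
    jet_zero r x (a - b) -> jet_zero r x (b - d) -> jet_zero r x (a - d).
  move=> sa sb sd z1 z2; have := jet_zero_lin 1 Ux (smooth_section_atB sa sb) (smooth_section_atB sb sd) z1 z2.
  by rewrite scale1r addrA subrK.
apply/seteqP; split=> u [su /jet_equivP H]; split=> //; apply/jet_equivP => //.
  by apply: (trans t s u) => //; [exact: jet_zero_sym|exact: H].
by apply: (trans s t u) => //; exact: H.
Qed.

Lemma jet_refl r x (s : section E) : U x -> smooth_section_at x s -> jet T r x s s.
Proof.
move=> Ux ss; split=> //; apply/jet_equivP => //; rewrite subrr; exact: jet_zero0.
Qed.

Lemma jet_mem r x (s t : section E) : U x -> smooth_section_at x s -> jet T r x s t ->
  smooth_section_at x t /\ jet_zero r x (s - t).
Proof. by move=> Ux ss [st /jet_equivP H]; split=> //; exact: H. Qed.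

End JetChar.

(** * Estimates for solutions *)

Section NearInj.
Context {R : realType} {n : nat} {M : manifold R n}.

Lemma near_bound U (h : M -> R) x0 : open U -> U x0 -> smooth U h ->
  \forall x \near x0, `|h x| <= `|h x0| + 1.
Proof.
move=> oU Ux sh; have ch := smooth_continuous oU Ux sh.
have /cvgr_dist_lt/(_ 1 ltr01) := ch; apply: filterS => x hx.
have -> : h x = h x0 - (h x0 - h x) by ring.
by rewrite (le_trans (ler_normB _ _)) // lerD2l ltW.
Qed.

Lemma near_bound_fin U (I : finType) (h : I -> M -> R) x0 : open U -> U x0 ->
  (forall i, smooth U (h i)) ->
  exists2 C, 0 <= C & \forall x \near x0, forall i, `|h i x| <= C.
Proof.
move=> oU Ux sh; exists (\sum_i (`|h i x0| + 1)); first by apply: sumr_ge0 => i _; rewrite addr_ge0.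
have : \forall x \near x0, forall i, `|h i x| <= `|h i x0| + 1.
  by apply: filter_forall => i; exact: near_bound oU Ux (sh i).
apply: filterS => x H i.
rewrite (le_trans (H i)) // (bigD1 i) //= lerDl; apply: sumr_ge0 => j _.
by rewrite addr_ge0.
Qed.

(* A right inverse [B] of the matrix [A x0] stays one up to the invertible factor
   [A x *m B]. *)
Lemma near_inj_bound U (I J : finType) (A : I -> J -> M -> R) x0 : open U -> U x0 ->
  (forall i j, smooth U (A i j)) ->
  (forall z : I -> R, (forall j, \sum_i z i * A i j x0 = 0) -> forall i, z i = 0) ->
  exists2 C, 0 <= C & \forall x \near x0, forall z : I -> R,
    \sum_i `|z i| <= C * \sum_j `|\sum_i z i * A i j x|.
Proof.
move=> oU Ux sA inj.
pose Am x := \matrix_(a < #|I|, b < #|J|) A (enum_val a) (enum_val b) x.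
have sAm a b : smooth U (fun x => Am x a b).
  by apply: smooth_ext (sA (enum_val a) (enum_val b)) => // x _; rewrite mxE.
have AmE x (z : I -> R) : (\row_a z (enum_val a)) *m Am x = \row_b \sum_i z i * A i (enum_val b) x.
  apply/rowP => b; rewrite !mxE [RHS](reindex (enum_val (A := I))) /=; last exact/onW_bij/enum_val_bij.
  by apply: eq_bigr => a _; rewrite !mxE.
have fA : row_free (Am x0).
  rewrite -kermx_eq0; apply/eqP/row_matrixP => a; rewrite row0.
  have kA : row a (kermx (Am x0)) *m Am x0 = 0 by rewrite -row_mul mulmx_ker row0.
  move: (row a _) kA => k kA.
  have kE : k = \row_a k 0 (enum_rank (enum_val a)) by apply/rowP => b; rewrite [RHS]mxE enum_valK.
  rewrite kE (AmE x0 (fun i => k 0 (enum_rank i))) in kA.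
  apply/rowP => b; rewrite mxE -(enum_valK b).
  apply: (inj (fun i => k 0 (enum_rank i))) => j.
  by move/rowP/(_ (enum_rank j)): kA; rewrite !mxE enum_rankK.
have /row_freeP[B AB] := fA.
have sAB i j : smooth U (fun x => (Am x *m B) i j).
  by apply: smooth_mulmx => // a b; exact: smooth_cst.
have [V [[oV Vx] VU uV]] : exists V, [/\ open_nbhs x0 V, V `<=` U &
    forall x, V x -> Am x *m B \in unitmx].
  by apply: near_unitmx => //; rewrite AB unitmx1.
pose H x := B *m invmx (Am x *m B).
have sH a b : smooth V (fun x => H x a b).
  apply: smooth_mulmx => //; first by move=> i j; exact: smooth_cst.
  apply: smooth_invmx => // i j; exact: smoothS (sAB i j).
have [C C0 HC] := near_bound_fin (I := ('I_#|J| * 'I_#|I|)%type) (h := fun p x => H x p.1 p.2) oV Vx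
  (fun p => sH p.1 p.2).
exists (#|I|%:R * C); first by rewrite mulr_ge0.
have := open_nbhs_nbhs (conj oV Vx); move: HC; apply: filterS2 => x HC Vx' z.
have zE : \row_a z (enum_val a) = (\row_b \sum_i z i * A i (enum_val b) x) *m H x.
  by rewrite -AmE /H mulmxA -(mulmxA _ (Am x)) mulmxK // uV.
have zi i : `|z i| <= C * \sum_j `|\sum_i z i * A i j x|.
  move/rowP/(_ (enum_rank i)): zE; rewrite [LHS]mxE enum_rankK [RHS]mxE => ->.
  rewrite (le_trans (ler_norm_sum _ _ _)) // mulr_sumr.
  rewrite [leRHS](reindex (enum_val (A := J))) /=; last exact/onW_bij/enum_val_bij.
  apply: ler_sum => b _; rewrite [X in `|X * _|]mxE normrM mulrC; apply: ler_wpM2r => //.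
  exact: (HC (b, enum_rank i)).
rewrite (le_trans (ler_sum _ (fun i _ => zi i))) // sumr_const -[leLHS]mulr_natl.
by rewrite mulrA.
Qed.

End NearInj.

(** * The operator of [phi] in local coordinates *)

Section DLocal.
Context {R : realType} {n : nat} {M : manifold R n} {T : filtration M}.
Context {N : nat} {o : 'I_N -> nat} {X : 'I_N -> vfield M}.
Context {c : chart R n M} {U : set M} {B : 'M[R]_(n, N)} (ad : adapted_frame T c U o X B).
Context {E F : vbundle M} {r : nat} (phi : jet_map T r E F).
Context {V0 : set M} {e : 'I_(vrank E) -> section E} (fe : frames (V0, e)).
Context {lam : forall x, 'I_(vrank E) -> {scalar E x}}.
Hypothesis lamP : dual_frame V0 e lam.
Context {V1 : set M} {f : 'I_(vrank F) -> section F} (ff : frames (V1, f)).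
Context {mu : forall x, 'I_(vrank F) -> {scalar F x}}.
Hypothesis muP : dual_frame V1 f mu.
Hypothesis UV0 : U `<=` V0.
Hypothesis UV1 : U `<=` V1.

Let oU : open U := ad_open ad.
Notation Xw := (word_op (X := X)).
Notation sc := (coord (lam := lam)).
Notation sf := (coord (lam := mu)).

Lemma jet_op_lin x a s t : smooth_section_at x s -> smooth_section_at x t ->
  jet_op phi (a *: s + t) x = a *: jet_op phi s x + jet_op phi t x.
Proof. exact: jmap_linear. Qed.

Lemma jet_op0 x : jet_op phi 0 x = 0.
Proof.
have := jet_op_lin (-1) (smooth_section_at0 x) (smooth_section_at0 x).
by rewrite scaler0 addr0 scaleN1r addNr.
Qed.

Lemma jet_op_sum x (I : Type) (s : seq I) (k : I -> R) (S : I -> section E) :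
  (forall i, smooth_section_at x (S i)) ->
  smooth_section_at x (\sum_(i <- s) k i *: S i) /\
  jet_op phi (\sum_(i <- s) k i *: S i) x = \sum_(i <- s) k i *: jet_op phi (S i) x.
Proof.
move=> sS; elim: s => [|i s [IH1 IH2]].
  by rewrite !big_nil; split; [exact: smooth_section_at0|exact: jet_op0].
rewrite !big_cons; split; first exact: smooth_section_at_lin.
by rewrite jet_op_lin // IH2.
Qed.

Lemma smooth_jet_op W s : open W -> smooth_section W s -> smooth_section W (jet_op phi s).
Proof. exact: jmap_smooth. Qed.

Lemma smooth_at_jet_op x s : smooth_section_at x s -> smooth_section_at x (jet_op phi s).
Proof. by move=> [W oW sW]; exists W => //; apply: smooth_jet_op => //; case: oW. Qed.

Lemma coord_sum (I : Type) (t : seq I) (k : I -> R)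
  (S : I -> section E) i : sc i (\sum_(j <- t) k j *: S j) = fun x => \sum_(j <- t) k j * sc i (S j) x.
Proof.
apply/funext => x; elim: t => [|j t IH].
  by rewrite !big_nil /coord section0 linear0.
by rewrite !big_cons coord_lin IH.
Qed.

(* If the words form a basis of the dual of J^r, phi has unique coefficients in it;
   they are smooth because they are determined by the values of the operator on
   the sections [sg], whose jets span J^r_x for all [x] near [x0]. *)
Lemma jet_op_local x0 : U x0 -> exists U' (P : 'I_(vrank F) -> 'I_(vrank E) -> (M -> R) -> M -> R),
  [/\ open_nbhs x0 U', U' `<=` U, forall k i, opspan (X := X) U' (std_word (o := o) r) (P k i) &
   forall x k s, U' x -> smooth_section_at x s ->
     sf k (jet_op phi s) x = \sum_i P k i (sc i s) x].
Proof.
move=> Ux0.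
pose L := std_words (o := o) r; pose K := size L.
pose W (i : 'I_K) := tnth (in_tuple L) i.
have WS i : std_word (o := o) r (W i) by rewrite -(mem_std_words ad) mem_tnth.
have Winj : injective W.
  by move=> i j /eqP; rewrite /W !(tnth_nth [::]) nth_uniq ?(uniq_std_words (o := o)) // => /eqP/val_inj.
(* Functions dual to the sorted words at [x0]. The matrix [Vm] of their word values is the identity
   there and remains invertible nearby. *)
have /choice[h hP] : forall j, exists h, smooth U h /\ forall i, Xw (W i) h x0 = (i == j)%:R.
  move=> j; have [h sh hE] := test_fun ad Ux0 r.+1 (fun w => (w == W j)%:R).
  exists h; split=> // i; have /andP[si wi] := WS i.
  rewrite hE //; first by rewrite (inj_eq Winj).
  by rewrite ltnS (leq_trans (size_wt ad _)).
pose Vm x : 'M[R]_K := \matrix_(i, j) Xw (W i) (h j) x.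
have sV i j : smooth U (fun x => Vm x i j).
  apply: (smooth_ext (f := Xw (W i) (h j))) => // [x _|]; first by rewrite mxE.
  by apply: (smooth_word_op ad) => //; exact: (hP j).1.
have [U' [[oU' Ux'] U'U uV]] : exists U', [/\ open_nbhs x0 U', U' `<=` U & forall x, U' x -> Vm x \in unitmx].
  apply: near_unitmx => //.
  suff -> : Vm x0 = 1%:M by rewrite unitmx1.
  by apply/matrixP => i j; rewrite !mxE (hP j).2.
pose sg (p : 'I_(vrank E) * 'I_K) : section E :=
  fun x => \sum_l ((l == p.1)%:R * h p.2 x) *: e l x.
have ssg p : smooth_section U (sg p).
  by apply: (smooth_section_comb fe) => // l; apply: smoothZ => //; exact: (hP p.2).1.
have scsg p l x : U x -> sc l (sg p) x = (l == p.1)%:R * h p.2 x.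
  by move=> Ux; rewrite (coord_comb lamP l (fun l x => (l == p.1)%:R * h p.2 x)) //; exact: UV0.
pose a k i b x := \sum_j sf k (jet_op phi (sg (i, j))) x * invmx (Vm x) j b.
have sVi i j : smooth U' (fun x => invmx (Vm x) i j).
  by apply: smooth_invmx => // i' j'; exact: smoothS (sV i' j').
have sa k i b : smooth U' (a k i b).
  apply: smooth_sum => // j _; apply: smoothM => //.
  apply: (coord_smooth ff muP) => //; first exact: subset_trans UV1.
  by apply: smooth_jet_op => //; exact: smooth_section_sub (ssg _).
exists U', (fun k i g x => \sum_b a k i b x * Xw (W b) g x); split=> //.
  by move=> k i; apply: os_sum => b; apply: osM => //; exact: osw.
move=> x k s Ux ss.
(* These coefficients make [s'] a combination of the sections [sg] with the same r-jet at [x] as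
   [s], so the operator takes the same value on both. *)
pose ka (p : 'I_(vrank E) * 'I_K) := \sum_b invmx (Vm x) p.2 b * Xw (W b) (sc p.1 s) x.
pose s' := \sum_p ka p *: sg p.
have Ux1 := U'U _ Ux.
have ssgx p : smooth_section_at x (sg p) by exists U.
have [ss' Ds'] := jet_op_sum (index_enum _) ka ssgx.
have sats l := coord_smooth_at fe lamP l (UV0 Ux1) ss.
have jE : jet T r x s = jet T r x s'.
  apply/(jet_eqP ad fe lamP UV0 r Ux1 ss ss') => w l; rewrite -(mem_std_words ad) => wS.
  have [b ->] : exists b, w = W b by have [b bE] := seq_tnthP wS; exists b.
  rewrite -[s - s'](addrC (- s')) -[- s']scaleN1r.
  have -> : sc l (-1 *: s' + s) = fun y => -1 * sc l s' y + sc l s y.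
    by apply/funext => y; rewrite coord_lin.
  have sat' := coord_smooth_at fe lamP l (UV0 Ux1) ss'.
  rewrite (word_opD ad) //; last by apply: smooth_atM => //; exact: smooth_at_cst.
  rewrite (word_opZ ad) // mulN1r; apply/eqP; rewrite addrC subr_eq0; apply/eqP.
  rewrite /s' coord_sum //.
  have hat p : smooth_at x (sc l (sg p)) by exact: (coord_smooth_at fe lamP l (UV0 Ux1)).
  rewrite (word_op_sum ad _ _ Ux1); last first.
    by move=> p; apply: smooth_atM => //; exact: smooth_at_cst.
  rewrite (eq_bigr (fun p => ka p * ((l == p.1)%:R * Vm x b p.2))); last first.
    move=> p _; rewrite (word_opZ ad) //; congr (_ * _).
    rewrite mxE -(word_opZ ad) //; last by apply: (smooth_at_in oU Ux1); exact: (hP p.2).1.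
    apply: (nbhs_singleton (word_op_near ad _ Ux1 _)).
    by apply: filterS (frame_near ad Ux1) => z Uz; exact: scsg.
  rewrite -(pair_big predT predT (fun i j => ka (i, j) * ((l == i)%:R * Vm x b j))) /=.
  rewrite (bigD1 l) //= [X in _ + X]big1 ?addr0; last first.
    by move=> i /negbTE il; rewrite big1 // => j _; rewrite eq_sym il mul0r mulr0.
  have /colP/(_ b) : Vm x *m (invmx (Vm x) *m \col_b Xw (W b) (sc l s) x) = \col_b Xw (W b) (sc l s) x.
    by rewrite mulmxA mulmxV ?mul1mx // uV.
  rewrite mxE [RHS]mxE => <-; apply: eq_bigr => j _.
  rewrite eqxx mul1r mulrC; congr (_ * _); rewrite /ka !mxE /=.
  by apply: eq_bigr => b' _; rewrite mxE.
rewrite /coord {1}/jet_op jE -/(jet_op phi s' x) Ds' raddf_sum.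
rewrite -(pair_big predT predT (fun i j => mu x k (ka (i, j) *: jet_op phi (sg (i, j)) x))) /=.
apply: eq_bigr => i _.
rewrite (eq_bigr (fun j => \sum_b (sf k (jet_op phi (sg (i, j))) x * invmx (Vm x) j b) * Xw (W b) (sc i s) x)).
  by rewrite exchange_big /=; apply: eq_bigr => b _; rewrite mulr_suml.
move=> j _; rewrite linearZ /= mulrC /ka mulr_sumr.
by apply: eq_bigr => b _; rewrite mulrA.
Qed.

End DLocal.

(** * Bounds for the jets of solutions, uniform in the solution *)

Section Estimates.
Context {R : realType} {n : nat} {M : manifold R n} {T : filtration M}.
Context {N : nat} {o : 'I_N -> nat} {X : 'I_N -> vfield M}.
Context {c : chart R n M} {U : set M} {B : 'M[R]_(n, N)} (ad : adapted_frame T c U o X B).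
Context {E F : vbundle M} {r : nat} (phi : jet_map T r E F).
Context {V0 : set M} {e : 'I_(vrank E) -> section E} (fe : frames (V0, e)).
Context {lam : forall x, 'I_(vrank E) -> {scalar E x}}.
Hypothesis lamP : dual_frame V0 e lam.
Context {V1 : set M} {f : 'I_(vrank F) -> section F} (ff : frames (V1, f)).
Context {mu : forall x, 'I_(vrank F) -> {scalar F x}}.
Hypothesis muP : dual_frame V1 f mu.
Hypothesis UV0 : U `<=` V0.
Hypothesis UV1 : U `<=` V1.

Let oU : open U := ad_open ad.
Notation Xw := (word_op (X := X)).
Notation sc := (coord (lam := lam)).
Notation sf := (coord (lam := mu)).
Notation sw := (std_word (o := o)).
Notation S := (std_words (o := o)).
Notation jz := (jet_zero (o := o) (X := X) (lam := lam)).
Notation jzF := (jet_zero (o := o) (X := X) (lam := mu)).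
Notation D := (jet_op phi).

(** Such a [P] is supplied by [jet_op_local] once [U] has been shrunk. *)
Variable P : 'I_(vrank F) -> 'I_(vrank E) -> (M -> R) -> M -> R.
Hypothesis oP : forall k i, opspan (X := X) U (sw r) (P k i).
Hypothesis DE : forall x k s, U x -> smooth_section_at x s ->
  sf k (D s) x = \sum_i P k i (sc i s) x.

Lemma solution_smooth_at s x : solution phi s -> smooth_section_at x s.
Proof. by move=> [ss _]; exists setT => //; split; [exact: openT|]. Qed.

Lemma smooth_section_near (G : vbundle M) x (s : section G) : smooth_section_at x s ->
  \forall z \near x, smooth_section_at z s.
Proof.
move=> [V oV ss]; apply: filterS (open_nbhs_nbhs oV) => z Vz.
by exists V => //; split=> //; case: oV.
Qed.

(** A row of the matrix of p_l(phi) in the word coordinates, with smooth entries. *)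
Lemma word_jet_op l v k : sw l v -> exists b : 'I_(vrank E) -> seq 'I_N -> M -> R,
  (forall i w, smooth U (b i w)) /\
  forall x s, U x -> smooth_section_at x s ->
    Xw v (sf k (D s)) x = \sum_i \sum_(w <- S (r + l)) b i w x * Xw w (sc i s) x.
Proof.
move=> /andP[sv vl].
have oPv i : opspan (X := X) U (sw (r + l)) (fun g => Xw v (P k i g)).
  apply: os_mono (os_word_op ad v (oP k i)) => w /andP[sww wl].
  by rewrite /std_word sww /=; lia.
have /choice[b bP] := fun i => os_coef ad (oPv i).
exists b; split; first by move=> i; exact: (bP i).1.
move=> x s Ux ss.
have sat i := coord_smooth_at fe lamP i (UV0 Ux) ss.
have -> : Xw v (sf k (D s)) x = Xw v (fun y => \sum_i P k i (sc i s) y) x.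
  apply: (nbhs_singleton (word_op_near ad _ Ux _)).
  have := smooth_section_near ss; have := frame_near ad Ux; apply: filterS2 => z Uz sz.
  exact: DE.
rewrite (word_op_sum ad _ _ Ux); last by move=> i; exact: (os_smooth_at ad (oP k i)).
by apply: eq_bigr => i _; exact: (bP i).2.
Qed.

Lemma jet_zero_val q x s t : U x -> smooth_section_at x s -> smooth_section_at x t ->
  jz q x (s - t) -> forall w i, sw q w -> Xw w (sc i s) x = Xw w (sc i t) x.
Proof.
move=> Ux ss st z w i sww; have := z w i sww.
have -> : sc i (s - t) = fun y => -1 * sc i t y + sc i s y.
  by apply/funext => y; rewrite -coord_lin scaleN1r addrC.
have sas := coord_smooth_at fe lamP i (UV0 Ux) ss.
have sat := coord_smooth_at fe lamP i (UV0 Ux) st.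
rewrite (word_opD ad) //; last by apply: smooth_atM => //; exact: smooth_at_cst.
by rewrite (word_opZ ad) // mulN1r addrC => /subr0_eq.
Qed.

(** Prolongation and projection are unions over all representatives of the jet. Each representative
    has the word values of [s] up to weight r+l, hence satisfies the same vanishing conditions. *)
Lemma symbol_mem l x s : (0 < l)%N -> U x -> smooth_section_at x s ->
  jzF l x (D s) -> jz (r + l).-1 x s -> symbol phi l x (jet T (r + l) x s).
Proof.
move=> l0 Ux ss zD zs.
have UsE := fun q a b => jet_eqP ad fe lamP UV0 q (x := x) (s := a) (t := b) Ux.
have UsF := fun q a b => jet_eqP ad ff muP UV1 q (x := x) (s := a) (t := b) Ux.
have s0 := smooth_section_at0 (E := E) x.
have s0F := smooth_section_at0 (E := F) x.
have sD a : smooth_section_at x a -> smooth_section_at x (D a) by exact: smooth_at_jet_op.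
have srefl : jet T (r + l) x s s by exact: (jet_refl ad fe lamP UV0).
split; [split|].
- by exists s.
- apply/seteqP; split=> [t [s' Hs']|t Ht].
    have [ss' zss'] := jet_mem ad fe lamP UV0 Ux ss Hs'.
    rewrite (iffRL (UsF l (D s') 0 (sD _ ss') s0F)) // subr0 => v k sv.
    have [b [sb bE]] := word_jet_op k sv.
    transitivity (Xw v (sf k (D s)) x); last exact: zD.
    rewrite !bE //; apply: eq_bigr => i _.
    rewrite !big_seq; apply: eq_bigr => w; rewrite (mem_std_words ad) => sww.
    by rewrite (jet_zero_val Ux ss ss' zss').
  exists s => //; rewrite (iffRL (UsF l (D s) 0 (sD _ ss) s0F)) //.
  by rewrite subr0.
apply/seteqP; split=> [t [s' Hs']|t Ht].
  have [ss' zss'] := jet_mem ad fe lamP UV0 Ux ss Hs'.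
  rewrite (iffRL (UsE (r + l).-1 s' 0 ss' s0)) // subr0 => w i sww.
  transitivity (Xw w (sc i s) x); last exact: zs.
  rewrite (jet_zero_val Ux ss ss' zss') //.
  by move: sww => /andP[sww wl]; rewrite /std_word sww /=; lia.
exists s => //; rewrite (iffRL (UsE (r + l).-1 s 0 ss s0)) //.
by rewrite subr0.
Qed.

Definition jet_norm q (s : section E) (x : M) : R :=
  \sum_(w <- S q) \sum_i `|Xw w (sc i s) x|.

Lemma jet_norm_ge0 q s x : 0 <= jet_norm q s x.
Proof. by apply: sumr_ge0 => w _; exact: sumr_ge0. Qed.

Definition nth_word q (i : 'I_(size (S q))) := tnth (in_tuple (S q)) i.

Lemma nth_word_std q i : sw q (@nth_word q i).
Proof. by rewrite -(mem_std_words ad) mem_tnth. Qed.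

Lemma big_std_words q (G : seq 'I_N -> R) : \sum_(w <- S q) G w = \sum_i G (@nth_word q i).
Proof. by rewrite [LHS]big_tnth. Qed.

Lemma nth_wordP q w : sw q w -> exists i, w = @nth_word q i.
Proof.
rewrite -(mem_std_words ad) => wS; have [i iE] := seq_tnthP wS.
by exists i.
Qed.

Lemma nth_word_inj q : injective (@nth_word q).
Proof.
by move=> i j /eqP; rewrite /nth_word !(tnth_nth [::]) nth_uniq ?(uniq_std_words (o := o)) // => /eqP/val_inj.
Qed.

(* [A] is the matrix of p_l(phi), combined with the projection onto J^{r+l-1}, in the
   coordinates given by the words; its kernel at [x0] is g^{r+l}. *)
Lemma top_estimate l x0 : (0 < l)%N -> U x0 ->
  symbol phi l x0 = [set jet T (r + l) x0 0] ->
  exists2 C, 0 <= C & \forall x \near x0, forall s, solution phi s ->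
    jet_norm (r + l) s x <= C * jet_norm (r + l).-1 s x.
Proof.
move=> l0 Ux0 symE.
pose I : finType := ('I_(size (S (r + l))) * 'I_(vrank E))%type.
pose J1 : finType := ('I_(size (S l)) * 'I_(vrank F))%type.
pose J2 : finType := ('I_(size (S (r + l).-1)) * 'I_(vrank E))%type.
have /choice[b bP] : forall j : J1, exists b : 'I_(vrank E) -> seq 'I_N -> M -> R,
  (forall i w, smooth U (b i w)) /\
  forall x s, U x -> smooth_section_at x s ->
    Xw (nth_word j.1) (sf j.2 (D s)) x = \sum_i \sum_(w <- S (r + l)) b i w x * Xw w (sc i s) x.
  by move=> j; apply: word_jet_op; exact: nth_word_std.
pose A (p : I) (j : (J1 + J2)%type) (x : M) : R :=
  match j with
  | inl j => b j p.2 (nth_word p.1) x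
  | inr j => (nth_word p.1 == nth_word j.1)%:R * (p.2 == j.2)%:R
  end.
pose zs s x (p : I) := Xw (nth_word p.1) (sc p.2 s) x.
have A1 s x j : U x -> smooth_section_at x s ->
    \sum_p zs s x p * A p (inl j) x = Xw (nth_word j.1) (sf j.2 (D s)) x.
  move=> Ux ss; rewrite (bP j).2 // -(pair_big predT predT (fun a i => zs s x (a, i) * A (a, i) (inl j) x)) /=.
  rewrite exchange_big /=; apply: eq_bigr => i _; rewrite big_std_words.
  by apply: eq_bigr => a _; rewrite mulrC.
have A2 s x j : \sum_p zs s x p * A p (inr j) x = Xw (nth_word j.1) (sc j.2 s) x.
  have [a aE] : exists a, nth_word j.1 = @nth_word (r + l) a.
    apply: nth_wordP; have /andP[sw1 w1] := nth_word_std j.1; rewrite /std_word sw1 /=; exact: leq_trans w1 (leq_pred _).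
  rewrite (bigD1 (a, j.2)) //= big1 ?addr0; last first.
    move=> [a' i'] ne; rewrite /A /= aE (inj_eq (@nth_word_inj _)).
    by move: ne; rewrite xpair_eqE negb_and => /orP[]/negbTE ->; rewrite ?mul0r !mulr0.
  by rewrite /zs /A /= aE !eqxx !mulr1.
have sA p j : smooth U (A p j).
  by case: j => j; [exact: (bP j).1|exact: smooth_cst].
(* A kernel vector is realised as the word values at [x0] of a section built from test functions;
   the jet of this section lies in the symbol, so it is 0. *)
have inj (z : I -> R) : (forall j, \sum_p z p * A p j x0 = 0) -> forall p, z p = 0.
  move=> Hz.
  have /choice[h hP] : forall i, exists h, smooth U h /\ forall a, Xw (@nth_word (r + l) a) h x0 = z (a, i).
    move=> i.
    pose t (w : seq 'I_N) := \sum_a (w == @nth_word (r + l) a)%:R * z (a, i).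
    have [h sh hE] := test_fun ad Ux0 (r + l).+1 t.
    exists h; split=> // a; have /andP[si wi] := nth_word_std a.
    rewrite hE //; last by rewrite ltnS (leq_trans (size_wt ad _)).
    rewrite /t (bigD1 a) //= eqxx mul1r big1 ?addr0 // => a' /negbTE ne.
    by rewrite (inj_eq (@nth_word_inj _)) eq_sym ne mul0r.
  pose s : section E := fun x => \sum_i h i x *: e i x.
  have ss : smooth_section_at x0 s.
    exists U; first by split.
    by apply: (smooth_section_comb fe) => // i; exact: (hP i).1.
  have zE p : zs s x0 p = z p.
    rewrite /zs (surjective_pairing p) /= -(hP p.2).2.
    apply: (nbhs_singleton (word_op_near ad _ Ux0 _)).
    apply: filterS (frame_near ad Ux0) => y Uy.
    by rewrite (coord_comb lamP p.2 h) //; exact: UV0.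
  have Hs j : \sum_p zs s x0 p * A p j x0 = 0.
    by rewrite -[RHS](Hz j); apply: eq_bigr => p _; rewrite zE.
  have mem : symbol phi l x0 (jet T (r + l) x0 s).
    apply: symbol_mem => //.
      by move=> v k /nth_wordP[a ->]; rewrite -(A1 s x0 (a, k)).
    by move=> w i /nth_wordP[a ->]; rewrite -(A2 s x0 (a, i)).
  rewrite symE /= in mem.
  have /(jet_eqP ad fe lamP UV0 (r + l) Ux0 ss (smooth_section_at0 x0)) := mem.
  rewrite subr0 => zs0 p; rewrite -zE; apply: zs0; exact: nth_word_std.
have [C C0 HC] := near_inj_bound oU Ux0 sA inj.
exists C => //; have := frame_near ad Ux0; move: HC; apply: filterS2 => x HC Ux s sol.
have ss := solution_smooth_at x sol.
have D0 : D s = 0 by case: sol.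
have := HC (zs s x).
have -> : \sum_p `|zs s x p| = jet_norm (r + l) s x.
  by rewrite /jet_norm big_std_words -(pair_big predT predT (fun a i => `|zs s x (a, i)|)).
move=> /le_trans; apply; apply: ler_wpM2l => //.
have -> : \sum_j `|\sum_p zs s x p * A p j x| =
    \sum_(j : J1) `|\sum_p zs s x p * A p (inl j) x| +
    \sum_(j : J2) `|\sum_p zs s x p * A p (inr j) x|.
  by rewrite big_sumType.
(* On a solution the block of p_l(phi) contributes nothing, and the other block is the norm of the
   projected jet. *)
rewrite [X in X + _]big1 ?add0r; last first.
  move=> j _; rewrite A1 // D0.
  have -> : sf j.2 0 = fun=> 0 by apply/funext => y; rewrite /coord section0 linear0.
  by rewrite (word_op0 ad) // normr0.
rewrite (eq_bigr (fun j : J2 => `|Xw (nth_word j.1) (sc j.2 s) x|)); last by move=> j _; rewrite A2.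
rewrite /jet_norm big_std_words.
by rewrite -(pair_big predT predT (fun a i => `|Xw (@nth_word (r + l).-1 a) (sc i s) x|)).
Qed.

Lemma iter_estimate q0 x0 : U x0 ->
  (forall j, exists2 C, 0 <= C & \forall x \near x0, forall s, solution phi s ->
    jet_norm (q0 + j).+1 s x <= C * jet_norm (q0 + j) s x) ->
  forall j, exists2 C, 0 <= C & \forall x \near x0, forall s, solution phi s ->
    jet_norm (q0 + j) s x <= C * jet_norm q0 s x.
Proof.
move=> Ux H; elim=> [|j [C C0 HC]].
  by exists 1 => //; apply: nearW => x s _; rewrite addn0 mul1r.
have [C' C'0 HC'] := H j; exists (C' * C); first exact: mulr_ge0.
move: HC HC'; apply: filterS2 => x HC HC' s sol.
rewrite addnS (le_trans (HC' s sol)) // -mulrA; apply: ler_wpM2l => //.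
exact: HC.
Qed.

(** Meant for unsorted words, such as a letter in front of a sorted one: sorting has smooth and
    therefore locally bounded coefficients. *)
Lemma word_estimate q w x0 : U x0 -> (wt (o := o) w <= q)%N ->
  exists2 C, 0 <= C & \forall x \near x0, forall i s, smooth_section_at x s ->
    `|Xw w (sc i s) x| <= C * jet_norm q s x.
Proof.
move=> Ux0 wq; have [b [sb bE]] := os_coef ad (word_std_span ad wq).
have [C C0 HC] := near_bound_fin (h := fun a : 'I_(size (S q)) => b (nth_word a)) oU Ux0 (fun a => sb _).
exists C => //; have := frame_near ad Ux0; move: HC; apply: filterS2 => x HC Ux i s ss.
rewrite bE //; last by apply: (coord_smooth_at fe lamP) => //; exact: UV0.
rewrite (le_trans (ler_norm_sum _ _ _)) // /jet_norm mulr_sumr !big_std_words.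
apply: ler_sum => a _; rewrite normrM; apply: ler_pM => //.
by rewrite (bigD1 i) //= lerDl; exact: sumr_ge0.
Qed.

(** The inequality |dJ| <= C |J|. A chart direction is expanded in the frame; the resulting
    derivatives have weight at most q + k and are brought back to weight q by the iterated
    estimate. *)
Lemma chart_estimate q x0 : U x0 ->
  (forall j, exists2 C, 0 <= C & \forall x \near x0, forall s, solution phi s ->
    jet_norm (q + j) s x <= C * jet_norm q s x) ->
  exists2 C, 0 <= C & \forall x \near x0, forall s, solution phi s ->
    forall w i a, sw q w ->
    `|chart_tvec c x a (Xw w (sc i s))| <= C * `|a| * jet_norm q s x.
Proof.
(* The sum serves only as a common bound for the weights of the letters. *)
move=> Ux0 H; pose k := (\sum_d o d)%N.
have ok d : (o d <= k)%N by rewrite /k (bigD1 d) //= leq_addr.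
have [C1 C10 H1] := H k.
have /choice[C2 H2] : forall p : 'I_N * 'I_(size (S q)), exists C, 0 <= C /\ \forall x \near x0,
   forall i s, smooth_section_at x s -> `|Xw (p.1 :: nth_word p.2) (sc i s) x| <= C * jet_norm (q + k) s x.
  move=> [d a]; have [|C C0 HC] := @word_estimate (q + k) (d :: nth_word a) _ Ux0; last by exists C.
  by rewrite wt_cons; have /andP[_] := nth_word_std a; have := ok d; lia.
have H2' : \forall x \near x0, forall p i s, smooth_section_at x s ->
    `|Xw (p.1 :: @nth_word q p.2) (sc i s) x| <= C2 p * jet_norm (q + k) s x.
  by apply: filter_forall => p; exact: (H2 p).2.
pose Hm x := B *m invmx (frame_mx c X x *m B).
have sH a b : smooth U (fun x => Hm x a b).
  apply: smooth_mulmx => //; first by move=> i j; exact: smooth_cst.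
  by move=> i j; exact: (smooth_inv_frame_mx ad).
have [C3 C30 H3] := near_bound_fin (I := ('I_n * 'I_N)%type) (h := fun p x => Hm x p.1 p.2) oU Ux0
  (fun p => sH p.1 p.2).
pose C4 := \sum_p C2 p.
have C4p p : C2 p <= C4.
  by rewrite /C4 (bigD1 p) //= lerDl; apply: sumr_ge0 => p' _; exact: (H2 p').1.
have C40 : 0 <= C4 by apply: sumr_ge0 => p' _; exact: (H2 p').1.
(* There are [N] frame fields; the coefficient of each is at most n C3 times the norm of [a], and
   its value on the word at most C4 C1 times [jet_norm q]. *)
exists (N%:R * (n%:R * C3) * (C4 * C1)); first by do !apply: mulr_ge0 => //.
near=> x => s sol w i a /nth_wordP[wa ->].
have Ux : U x by near: x; exact: (frame_near ad Ux0).
have ss := solution_smooth_at x sol.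
have dx := ad_dom ad Ux.
have Tv : T (fdepth T) x (chart_tvec c x a).
  by rewrite fsub_top //; exists c, a; split=> //; exact: (ad_atlas ad).
have fE : frame_coef (c := c) (X := X) (B := B) (chart_tvec c x a) x = a *m Hm x.
  rewrite /frame_coef /Hm mulmxA; congr (_ *m _ *m _); apply/rowP => j.
  by rewrite mxE chart_tvec_coord //; exact: (ad_atlas ad).
rewrite (frame_coefE ad Ux Tv) fE /comb tvec_sumE (le_trans (ler_norm_sum _ _ _)) //.
have H1x : forall s, solution phi s -> jet_norm (q + k) s x <= C1 * jet_norm q s x by near: x; exact: H1.
have H2x : forall p i s, smooth_section_at x s ->
  `|Xw (p.1 :: @nth_word q p.2) (sc i s) x| <= C2 p * jet_norm (q + k) s x by near: x; exact: H2'.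
have H3x : forall p, `|Hm x p.1 p.2| <= C3 by near: x; exact: H3.
have cd d : `|(a *m Hm x) 0 d| <= n%:R * C3 * `|a|.
  rewrite [X in `|X|]mxE (le_trans (ler_norm_sum _ _ _)) //.
  rewrite (le_trans (y := \sum_(i < n) (C3 * `|a|))) //; last first.
    by rewrite sumr_const card_ord -[leLHS]mulr_natl mulrA.
  apply: ler_sum => j _; rewrite normrM mulrC; apply: ler_pM => //; first exact: (H3x (j, d)).
  by rewrite [leRHS]/Num.Def.normr/= mx_normrE; apply: (le_bigmax _ _ (0, j)).
have xd d : `|X d x (Xw (nth_word wa) (sc i s))| <= C4 * C1 * jet_norm q s x.
  rewrite (le_trans (H2x (d, wa) i s ss)) // -mulrA; apply: ler_pM => //.
  - exact: (H2 (d, wa)).1.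
  - exact: jet_norm_ge0.
  - exact: H1x.
rewrite (le_trans (y := \sum_(d < N) (n%:R * C3 * `|a| * (C4 * C1 * jet_norm q s x)))) //.
  by apply: ler_sum => d _; rewrite normrM; apply: ler_pM.
rewrite sumr_const card_ord -[leLHS]mulr_natl le_eqVlt; apply/orP; left; apply/eqP.
by ring.
Unshelve. all: by end_near. Qed.

End Estimates.

(** * Uniqueness and finite dimension *)

(** The sum h of squares, differentiable unlike the sum of absolute values, satisfies h' <= L h. So
    h(t) exp(-L t) does not increase; it starts at 0 and is nonnegative. *)
Lemma gronwall_eq0 (R : realType) (I : finType) (g : I -> R -> R) (C : R) : 0 <= C ->
  (forall i (t : R), 0 <= t <= 1 -> derivable (g i) t 1 /\ `|'D_1 (g i) t| <= C * \sum_j `|g j t|) ->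
  (forall i, g i 0 = 0) -> forall i, g i 1 = 0.
Proof.
move=> C0 Hg g0.
pose h t := \sum_i g i t ^+ 2.
(* From 2 |g_i| |g_j| <= g_i^2 + g_j^2, summed over all pairs of indices. *)
pose L := C * #|I|%:R * 2.
pose p t := h t * expR (- L * t).
pose dh t := \sum_i ((2%:R * g i t) * 'D_1 (g i) t).
have Dh (t : R) : 0 <= t <= 1 -> is_derive t 1 h (dh t).
  move=> t01; rewrite /h /dh.
  have -> : (fun t => \sum_i g i t ^+ 2) = \sum_i (g i) ^+ 2.
    by apply/funext => z; rewrite fct_sumE; apply: eq_bigr => i _; rewrite -[RHS]/((g i ^+ 2) z) exprfctE.
  have H i : is_derive t 1 ((g i) ^+ 2) ((2%:R * g i t) * 'D_1 (g i) t).
    have := is_deriveX 2 (derivableP (Hg i t t01).1).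
    by rewrite /= expr1.
  elim/big_ind2 : _ => //; first exact: is_derive_cst.
  by move=> f1 a1 f2 a2 *; exact: is_deriveD.
have De (t : R) : is_derive t 1 (fun t => expR (- L * t)) (- L * expR (- L * t)).
  have : is_derive t 1 (expR \o ( *%R (- L))) (- L * expR (- L * t)).
    rewrite mulrC; apply: is_derive1_comp; rewrite -[X in is_derive _ _ _ X]mulr1.
    exact: is_deriveZ.
  by [].
have Dp (t : R) : 0 <= t <= 1 -> is_derive t 1 p ((dh t - L * h t) * expR (- L * t)).
  move=> t01; have := is_deriveM (Dh t t01) (De t).
  move=> H; apply: (is_derive_eq H); rewrite /GRing.scale /=; ring.
have dhL (t : R) : 0 <= t <= 1 -> dh t <= L * h t.
  move=> t01.
  have : dh t <= \sum_i \sum_j (C * (g i t ^+ 2 + g j t ^+ 2)).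
    apply: ler_sum => i _; rewrite (le_trans (ler_norm _)) // normrM normrM ger0_norm //.
    rewrite (le_trans (ler_wpM2l _ (Hg i t t01).2)) //.
    rewrite mulrCA -mulr_sumr; apply: ler_wpM2l => //; rewrite mulr_sumr.
    apply: ler_sum => j _; rewrite -(real_normK (num_real (g i t))) -(real_normK (num_real (g j t))).
    by have := sqr_ge0 (`|g i t| - `|g j t|); nra.
  move=> /le_trans; apply.
  have -> : \sum_i \sum_j (C * (g i t ^+ 2 + g j t ^+ 2)) = L * h t; last by [].
  under eq_bigr => i _ do rewrite -mulr_sumr big_split /= sumr_const -mulr_natl.
  rewrite -mulr_sumr big_split /= -mulr_sumr sumr_const -[X in _ + X]mulr_natl /L /h.
  by rewrite -!/(h t); ring.
have p1 : p 1 <= p 0.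
  have cp : {within `[0 : R, 1], continuous p}.
    apply: derivable_within_continuous => t; rewrite in_itv /= => t01.
    by have [] := Dp t t01.
  have in01 (t : R) : t \in `]0, 1[%R -> 0 <= t <= 1 by rewrite in_itv /= => /andP[/ltW -> /ltW ->].
  apply: (@ler0_derive1_le_cc _ p 0 1 _ _ cp) => //.
  - by move=> t /in01 t01; have [] := Dp t t01.
  - move=> t /in01 t01; rewrite derive1E; have [_ ->] := Dp t t01.
    by apply: mulr_le0_ge0; [rewrite subr_le0; exact: dhL|exact: expR_ge0].
  - by rewrite in_itv /= lexx ler01.
  - by rewrite in_itv /= lexx ler01.
have h0 : h 0 = 0 by rewrite /h big1 // => i _; rewrite g0 expr0n.
have h1 : h 1 <= 0.
  by move: p1; rewrite /p h0 mul0r pmulr_lle0 // expR_gt0.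
move=> i; apply/eqP; rewrite -sqrf_eq0 eq_le sqr_ge0 andbT (le_trans _ h1) //.
by rewrite /h (bigD1 i) //= lerDl; apply: sumr_ge0 => j _; exact: sqr_ge0.
Qed.

Lemma derive_line (R : realType) n (f : 'rV[R]_n -> R) (y d : 'rV[R]_n) (t : R) :
  differentiable f (y + t *: d) ->
  derivable (fun u : R => f (y + u *: d)) t 1 /\
  'D_1 (fun u : R => f (y + u *: d)) t = 'D_d f (y + t *: d).
Proof.
move=> df; have dd : derivable f (y + t *: d) d by exact: diff_derivable.
have E : (fun h : R => h^-1 *: (((fun u : R => f (y + u *: d)) \o shift t) (h *: (1 : R)) - f (y + t *: d))) =
    (fun h : R => h^-1 *: ((f \o shift (y + t *: d)) (h *: d) - f (y + t *: d))).
  apply/funext => h /=; congr (_ *: (f _ - _)).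
  have -> : h *: (1 : R) = h by exact: mulr1.
  by rewrite scalerDl addrCA.
by split; [rewrite /derivable|rewrite /derive]; rewrite E.
Qed.

(** [ev] is linear and injective on [W] only. A family in [W] with independent images has at most K
    members, and one of maximal size is a basis. *)
Lemma finite_dim_basis (R : realType) (V : lmodType R) (W : set V) K (ev : V -> 'rV[R]_K) :
  W 0 -> (forall a u v, W u -> W v -> W (a *: u + v)) ->
  (forall a u v, W u -> W v -> ev (a *: u + v) = a *: ev u + ev v) ->
  (forall u, W u -> ev u = 0 -> u = 0) ->
  exists (d : nat) (e : 'I_d -> V), is_basis_mod W [set 0] e.
Proof.
move=> W0 Wl el ei.
have ev0 : ev 0 = 0.
  by have := el (-1) 0 0 W0 W0; rewrite scaler0 addr0 scaleN1r addNr.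
have comb d (e : 'I_d -> V) (k : 'rV[R]_d) : (forall i, W (e i)) ->
    W (\sum_i k 0 i *: e i) /\ ev (\sum_i k 0 i *: e i) = k *m (\matrix_i ev (e i)).
  move=> We; rewrite mulmx_sum_row.
  elim/big_ind2 : _; [by rewrite ev0|move=> u a v b [Wu ua] [Wv vb]|move=> i _].
    have := Wl 1 _ _ Wu Wv; have := el 1 _ _ Wu Wv.
    by rewrite !scale1r ua vb.
  rewrite rowK -[_ *: e i]addr0; split; first exact: (Wl _ _ _ (We i) W0).
  by rewrite el // ev0 addr0.
pose P d := `[< exists e : 'I_d -> V, (forall i, W (e i)) /\ row_free (\matrix_i ev (e i)) >].
have exP : exists d, P d.
  exists 0%N; apply/asboolP; exists (fun=> 0); split=> //.
  by rewrite /row_free -leqn0 rank_leq_row.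
have leP d : P d -> (d <= K)%N.
  by move=> /asboolP[e [_ /eqP rf]]; rewrite -rf rank_leq_col.
case: (ex_maxnP exP leP) => d /asboolP[e [We rf]] dmax.
exists d, e; split=> [v|k /= kE]; last first.
  have [_] := comb d e k We; rewrite kE ev0 => /esym/eqP.
  by rewrite mulmx_free_eq0 // => /eqP.
split=> [Wv|[k /= /subr0_eq ->]]; last exact: (comb d e k We).1.
have sub : (ev v <= \matrix_i ev (e i))%MS.
  (* Otherwise [v] could be added to the family, against maximality. *)
  apply/negPn/negP => nsub; suff : P d.+1 by move/dmax; rewrite ltnn.
  apply/asboolP; exists (fun i : 'I_(1 + d) => match fintype.split i with inl _ => v | inr j => e j end).
  split; first by move=> i; case: fintype.split.
  have -> : \matrix_(i < 1 + d) ev (match fintype.split i with inl _ => v | inr j => e j end) =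
     col_mx (ev v) (\matrix_i ev (e i)).
    apply/matrixP => i j; rewrite !mxE; case: fintype.split => k; last by rewrite mxE.
    by rewrite ord1.
  rewrite /row_free eqn_leq rank_leq_row /=.
  have <- : \rank (ev v + \matrix_i ev (e i))%MS = \rank (col_mx (ev v) (\matrix_i ev (e i))).
    by rewrite addsmxE.
  by rewrite -[X in (X < _)%N](eqP rf); apply: rank_ltmx; rewrite ltmxE addsmxSr /= addsmx_sub negb_and nsub.
have [k kE] := submxP sub; exists k => /=.
have [Wk Ek] := comb d e k We.
have Wvk : W (v - \sum_i k 0 i *: e i).
  by have := Wl (-1) _ _ Wk Wv; rewrite scaleN1r addrC.
apply: ei => //; have := el (-1) _ _ Wk Wv; rewrite scaleN1r addrC => ->.
by rewrite Ek kE scaleN1r addNr.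
Qed.

(** * From local propagation of zero jets to the theorem *)

Section Solutions.
Context {R : realType} {n : nat} {M : manifold R n} {T : filtration M}.
Context {r : nat} {E F : vbundle M} (phi : jet_map T r E F).

Lemma solution_lin (a : R) s t : solution phi s -> solution phi t -> solution phi (a *: s + t).
Proof.
move=> [ss Ds] [st Dt]; split; first by apply: smooth_section_lin => //; exact: openT.
have sat u x : smooth_section setT u -> smooth_section_at (E := E) x u.
  by move=> su; exists setT => //; split; [exact: openT|].
apply: functional_extensionality_dep => x.
by rewrite jet_op_lin; [rewrite Ds Dt !section0 scaler0 addr0|exact: sat|exact: sat].
Qed.

Lemma solution0 : solution phi 0.
Proof.
split; first exact/smooth_section0/openT.
by apply: functional_extensionality_dep => x; rewrite jet_op0.
Qed.

(** The four conclusions share the choice of chart, frame and trivialisations around [x0] and are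
    stated without them. The first treats the two points symmetrically, so it yields both openness
    and closedness of the zero set of the jet. *)
Lemma solutions_near m x0 :
  (forall x l, (0 < l)%N -> (m <= l)%N -> symbol phi l x = [set jet T (r + l) x 0]) ->
  [/\ exists2 W, open_nbhs x0 W & forall s x x', solution phi s -> W x -> W x' ->
        jet_equiv T (r + m) x s 0 -> jet_equiv T (r + m) x' s 0,
      exists K (ev : section E -> 'rV[R]_K),
        (forall a s t, solution phi s -> solution phi t -> ev (a *: s + t) = a *: ev s + ev t) /\
        (forall s, solution phi s -> ev s = 0 -> jet_equiv T (r + m) x0 s 0),
      forall s, solution phi s -> jet_equiv T (r + m) x0 s 0 -> s x0 = 0 &
      forall s t, solution phi s -> solution phi t -> jet T (r + m) x0 s = jet T (r + m) x0 t ->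
        jet_equiv T (r + m) x0 (s - t) 0].
Proof.
move=> ft; set q := (r + m)%N.
have [c [U0 [N [ o [X [B [U0x ad0]]]]]]] := adapted_frame_exists T x0.
have [V0 [e [fe V0x]]] := frames_cover E x0.
have [V1 [f [ff V1x]]] := frames_cover F x0.
have [lam lamP] := dual_frame_exists fe; have [mu muP] := dual_frame_exists ff.
have oV0 : open V0 by case: (frames_basis fe).
have oV1 : open V1 by case: (frames_basis ff).
pose U1 := U0 `&` V0 `&` V1.
have U1U0 : U1 `<=` U0 by move=> x [[]].
have U1V0 : U1 `<=` V0 by move=> x [[]].
have U1V1 : U1 `<=` V1 by move=> x [].
have oU1 : open U1 by do !apply: openI => //; exact: (ad_open ad0).
have U1x : U1 x0 by [].
have ad1 := adapted_frame_sub oU1 U1U0 ad0.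
have [U [P [[oU Ux] UU1 oP DE]]] := jet_op_local ad1 phi fe lamP ff muP U1V0 U1V1 U1x.
have ad := adapted_frame_sub oU UU1 ad1.
have UV0 := subset_trans UU1 U1V0; have UV1 := subset_trans UU1 U1V1.
pose nm := jet_norm (o := o) (X := X) (lam := lam).
(* The passage from weight q+j+1 to q+j uses l = m+j+1, which is positive and at least [m]. *)
have step j : exists2 C, 0 <= C & \forall x \near x0, forall s, solution phi s ->
    nm (q + j).+1 s x <= C * nm (q + j)%N s x.
  have := top_estimate ad fe lamP ff muP UV0 UV1 oP DE (ltn0Sn (m + j)) Ux (ft x0 _ (ltn0Sn _) (leqW (leq_addr j m))).
  by rewrite !addnS addnA -/q.
have iter := iter_estimate Ux step.
have [C C0 HC] := chart_estimate ad fe lamP UV0 Ux iter.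
have s0 x := smooth_section_at0 (E := E) x.
have jzP s x : U x -> solution phi s -> jet_equiv T q x s 0 <-> jet_zero (o := o) (X := X) (lam := lam) q x s.
  move=> Ux' sol; have := jet_equivP ad fe lamP UV0 q Ux' (solution_smooth_at x sol) (s0 x).
  by rewrite subr0.
have satx s i x : U x -> solution phi s -> smooth_at x (coord (lam := lam) i s).
  by move=> Ux' sol; apply: (coord_smooth_at fe lamP); [exact: UV0|exact: solution_smooth_at sol].
split.
- have HU := frame_near ad Ux.
  have : \forall x \near x0, U x /\ forall s, solution phi s -> forall w i a, std_word (o := o) q w ->
    `|chart_tvec c x a (word_op (X := X) w (coord (lam := lam) i s))| <= C * `|a| * nm q s x.
    by move: HU HC; apply: filterS2.
  rewrite /prop_near1 nbhsE => -[V [oV Vx] VH].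
  have ac := ad_atlas ad.
  have VU : V `<=` U by move=> x /VH[].
  have Vc : V `<=` cdom c by move=> x /VU; exact: (ad_dom ad).
  have [_ _ _ _ cK] := atlas_chart ac.
  have VI : cdom c `&` V = V by apply/setIidPr.
  have oI : open (cmap c @` V) by rewrite -VI; exact: chart_open.
  have /nbhs_ballP[eps /= eps0 Hball] : nbhs (cmap c x0) (cmap c @` V).
    by apply: open_nbhs_nbhs; split=> //; exists x0.
  (* A ball is convex, so the segment joining the chart images of two such points stays in the image
     of [V], where the estimate holds. *)
  exists (V `&` cmap c @^-1` (ball (cmap c x0) eps)).
    split; last by split=> //=; exact: ballxx.
    rewrite openE => z [Vz bz]; rewrite /interior; apply: filterI.
      exact: open_nbhs_nbhs.
    apply: (chart_continuous ac (Vc _ Vz)).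
    by apply: open_nbhs_nbhs; split=> //; exact: ball_open.
  move=> s x x' sol [Vx1 bx] [Vx' bx'] zx; apply/(jzP s x' (VU _ Vx') sol) => w i sww.
  have {}zx := (jzP s x (VU _ Vx1) sol).1 zx.
  pose y := cmap c x; pose d := cmap c x' - y.
  pose ga (t : R) := y + t *: d.
  have inV t : 0 <= t <= 1 -> exists2 z, V z & cmap c z = ga t.
    move=> /andP[t0 t1]; apply: Hball; rewrite -ball_normE /= /ga /d.
    move: bx bx'; rewrite /= -ball_normE /= => bx bx'.
    have -> : cmap c x0 - (y + t *: (cmap c x' - y)) =
      (1 - t) *: (cmap c x0 - y) + t *: (cmap c x0 - cmap c x').
      by apply/rowP => i'; rewrite !mxE; ring.
    rewrite (le_lt_trans (ler_normD _ _)) // !normrZ !ger0_norm ?subr_ge0 //.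
    (* For positive t the strict inequality comes from the endpoint [x'], at t = 0 from [x]. *)
    have [t10|t10] := eqVneq t 0.
      by rewrite t10 subr0 mul1r mul0r addr0.
    have tp : 0 < t by rewrite lt_neqAle eq_sym t10.
    rewrite [ltRHS](_ : eps = (1 - t) * eps + t * eps); last by ring.
    by apply: ler_ltD; [apply: ler_wpM2l; rewrite ?subr_ge0 // ltW|rewrite ltr_pM2l].
  pose I : finType := ('I_(size (std_words (o := o) q)) * 'I_(vrank E))%type.
  pose g (p : I) (t : R) := (word_op (X := X) (nth_word p.1) (coord (lam := lam) p.2 s) \o cinv c) (ga t).
  have gE p t z : V z -> cmap c z = ga t -> g p t = word_op (X := X) (nth_word p.1) (coord (lam := lam) p.2 s) z.
    by move=> Vz zE; rewrite /g /= -zE cK //; exact: Vc.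
  have nE t z : V z -> cmap c z = ga t -> \sum_p `|g p t| = nm q s z.
    move=> Vz zE; rewrite /nm /jet_norm big_std_words (eq_bigr (fun p : I =>
      `|word_op (X := X) (nth_word p.1) (coord (lam := lam) p.2 s) z|)); last by move=> p _; rewrite (gE p t z).
    by rewrite -(pair_big predT predT (fun a i => `|word_op (X := X) (@nth_word _ o q a) (coord (lam := lam) i s) z|)).
  have g1 : forall p, g p 1 = 0.
    (* The segment has constant velocity [d], whose norm enters through the chart estimate. *)
    apply: (@gronwall_eq0 R I g (C * `|d|)); first exact: mulr_ge0.
      move=> p t t01; have [z Vz zE] := inV t t01.
      have [Uz Hz] := VH z Vz.
      have sz : smooth_at z (word_op (X := X) (nth_word p.1) (coord (lam := lam) p.2 s)).
        by apply: (smooth_at_word_op ad) => //; exact: satx.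
      have df := smooth_at_diff ac (Vc _ Vz) sz.
      have [|H1 H2] := @derive_line R n (word_op (X := X) (nth_word p.1) (coord (lam := lam) p.2 s) \o cinv c) y d t.
        by rewrite -/(ga t) -zE.
      split=> //; rewrite (nE t z Vz zE).
      have := Hz s sol (nth_word p.1) p.2 d (nth_word_std ad p.1).
      by rewrite /chart_tvec asboolT // zE -H2.
    move=> p; rewrite (gE p 0 x) //; last by rewrite /ga scale0r addr0.
    by apply: zx; exact: (nth_word_std ad).
  have [a aE] := nth_wordP ad sww.
  have := g1 (a, i); rewrite (gE (a, i) 1 x') //; last by rewrite /ga scale1r /d addrC subrK.
  by rewrite /= -aE.
- pose I : finType := ('I_(size (std_words (o := o) q)) * 'I_(vrank E))%type.
  pose ev s : 'rV[R]_#|I| := \row_b word_op (X := X) (nth_word (enum_val b).1) (coord (lam := lam) (enum_val b).2 s) x0.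
  exists #|I|, ev; split=> [a s t ss st|s sol ev0].
    apply/rowP => b; rewrite !mxE.
    have -> : coord (lam := lam) (enum_val b).2 (a *: s + t) =
      fun y => a * coord (lam := lam) (enum_val b).2 s y + coord (lam := lam) (enum_val b).2 t y.
      by apply/funext => y; rewrite coord_lin.
    rewrite (word_opD ad) //; [|by apply: smooth_atM; [exact: smooth_at_cst|exact: satx]|exact: satx].
    by rewrite (word_opZ ad) //; exact: satx.
  apply/(jzP s x0 Ux sol) => w i /(nth_wordP ad)[a ->].
  by have /rowP/(_ (enum_rank ((a, i) : I))) := ev0; rewrite !mxE enum_rankK.
- move=> s sol /(jzP s x0 Ux sol) z.
  rewrite ((lamP x0 V0x).2 (s x0)) big1 // => i _.
  (* The empty word has weight 0: the jet contains the value of the section. *)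
  have := z [::] i; rewrite /= /coord => ->; first by rewrite scale0r.
  by rewrite /std_word /= /wt big_nil.
- move=> s t ss st jE.
  have sst : solution phi (s - t).
    by rewrite addrC -scaleN1r; exact: solution_lin.
  apply/(jzP _ x0 Ux sst).
  by move/(jet_eqP ad fe lamP UV0 q Ux (solution_smooth_at x0 ss) (solution_smooth_at x0 st)) : jE.
Qed.

Lemma solution_eq0 m s x : connected [set: M] ->
  (forall x l, (0 < l)%N -> (m <= l)%N -> symbol phi l x = [set jet T (r + l) x 0]) ->
  solution phi s -> jet_equiv T (r + m) x s 0 -> s = 0.
Proof.
move=> conn ft sol zx.
pose Z := [set y | jet_equiv T (r + m) y s 0].
have ZT : Z = setT.
  apply: conn; first by exists x.
  - exists Z; last by rewrite setTI.
    rewrite openE => y Zy; have [[W oW HW] _ _ _] := solutions_near y ft.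
    apply: filterS (open_nbhs_nbhs oW) => z Wz.
    by apply: (HW s y z) => //; case: oW.
  - exists Z; last by rewrite setTI.
    rewrite -[Z]setCK; apply: open_closedC.
    rewrite openE => y Zy; have [[W oW HW] _ _ _] := solutions_near y ft.
    apply: filterS (open_nbhs_nbhs oW) => z Wz Zz; apply: Zy.
    by apply: (HW s z y) => //; case: oW.
apply: functional_extensionality_dep => y.
have [_ _ H _] := solutions_near y ft; apply: H => //.
by have : Z y by rewrite ZT.
Qed.

End Solutions.

Theorem mainTheorem2 (R : realType) (n : nat) (M : manifold R n)
    (T : filtration M) (E F : vbundle M) (r : nat) (phi : jet_map T r E F) :
  connected [set: M] ->
  gr_locally_trivial T ->
  (forall x, gr_generated_by_deg1 T x) ->
  constant_rank phi ->
  (regular phi -> finite_type phi ->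
     exists N : nat, forall (x : M) (s t : section E),
       solution phi s -> solution phi t ->
       jet T N x s = jet T N x t -> s = t) /\
  (finite_type phi ->
     exists (d : nat) (e : 'I_d -> section E),
       is_basis_mod (solution phi) [set 0] e).
Proof.
move=> conn _ _ _; split=> [_ [m ft]|[m ft]].
  exists (r + m)%N => x s t ss st jE.
  have [_ _ _ H] := solutions_near x ft.
  have sst : solution phi (s - t) by rewrite addrC -scaleN1r; exact: solution_lin.
  exact/subr0_eq/(solution_eq0 conn ft sst)/(H s t ss st jE).
have [[x _]|nM] := pselect (exists x : M, True).
  have [_ [K [ev [evl ev0]]] _ _] := solutions_near x ft.
  apply: (finite_dim_basis (solution0 phi) _ evl); first by move=> a u v; exact: solution_lin.
  by move=> u su eu; apply: (solution_eq0 conn ft su (x := x)); exact: ev0.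
(* On the empty manifold there is no point at which to take a jet, but 0 is the only section. *)
exists 0%N, (fun=> 0); split=> [v|k _]; last by apply/rowP => -[].
have all0 (u : section E) : u = 0.
  by apply: functional_extensionality_dep => x; case: nM; exists x.
split=> _; last by rewrite (all0 v); exact: solution0.
by exists 0; exact: all0.
Qed.
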